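(* For any integer $k\ge3$, any real $1\le p<k$, and $b\in\{0,1\}$, there exists a computable $(p,k,C_b,\varepsilon)$-isolating parallelepiped for some \[ \varepsilon\ \ge\ \frac{|\sin(\pi p/2)|}{p^2}\cdot\Big(\frac{2p}{e^2\pi^2k}\Big)^{(p+1)/2}. \] Up to scaling, this is achieved (in $\{-1,1\}$ coordinates) by the following parallelepiped: let $\eta:=\lfloor k/2\rfloor+\lfloor p/2\rfloor$, $\alpha_{\vec u}:=1+(-1)^{\eta+b}\prod_{i}u_i$ for $\vec u\in\{-1,1\}^k$, and $t^*:=(1+(-1)^{k+1})/2$; let $W\in\mathbb{R}^{2^k\times k}$ be the matrix whose row indexed by $\vec u$ is $\alpha_{\vec u}^{1/p}\vec u^T$ and $\vec w\in\mathbb{R}^{2^k}$ the vector with $w_{\vec u}=\alpha_{\vec u}^{1/p}t^*$; then $\|W\vec y-\vec w\|_p^p$, for $\vec y\in\{-1,1\}^k$, takes one value $a$ when $\vec y$ corresponds (via $\vec y=\vec 1-2\vec x$) to $\vec x\in C_b^{-1}(1)$ and another value $a(1+\varepsilon)^p$ when $\vec x\in C_b^{-1}(0)$.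
   Context: $\|\vec x\|_p=(\sum_i|x_i|^p)^{1/p}$. $C_1(x_1,\dots,x_k):=x_1\oplus\cdots\oplus x_k$ and $C_0:=\neg C_1$. For a constraint $C:\{0,1\}^k\to\{0,1\}$ and $\varepsilon\ge0$, $V\in\mathbb{R}^{d^*\times k}$ with full column rank and $\vec t^*\in\mathbb{R}^{d^*}$ define a $(p,k,C,\varepsilon)$-isolating parallelepiped if $\|V\vec x-\vec t^*\|_p=1$ for all $\vec x\in C^{-1}(1)$ and $\|V\vec x-\vec t^*\|_p=1+\varepsilon$ for all $\vec x\in C^{-1}(0)$. Passing from $\{-1,1\}$ coordinates to $\{0,1\}$ coordinates means using $V=-2W$, $\vec t^*=\vec w-W\vec 1$, so that $\|V\vec x-\vec t^*\|_p=\|W(\vec 1-2\vec x)-\vec w\|_p$, and then scaling. *)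

(* Defs.v *)
From HB Require Import structures.
From mathcomp Require Import all_boot all_order all_algebra.
From mathcomp Require Import all_classical all_reals all_analysis.

Set Implicit Arguments.
Unset Strict Implicit.
Unset Printing Implicit Defensive.

Import Order.TTheory GRing.Theory Num.Theory.
Import numFieldNormedType.Exports.

Local Open Scope ring_scope.

Definition lpnorm (R : realType) (p : R) (d : nat) (x : 'cV[R]_d) : R :=
  (\sum_(i < d) `|x i 0| `^ p) `^ (p^-1).

(* Points of {0,1}^k and of {-1,1}^k are both represented by Boolean vectors;
   [bit_col] reads x as a 0/1 vector, and [sign_col] applies y = 1 - 2x. *)
Notation boolvec k := {ffun 'I_k -> bool}.

Definition bit_col (R : realType) (k : nat) (x : boolvec k) : 'cV[R]_k :=
  \col_i (x i)%:R.

Definition sign_col (R : realType) (k : nat) (x : boolvec k) : 'cV[R]_k :=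
  const_mx 1 - 2 *: bit_col R x.

Definition parity_constraint (b : bool) (k : nat) (x : boolvec k) : bool :=
  if b then \big[addb/false]_(i < k) x i
  else ~~ \big[addb/false]_(i < k) x i.

Definition isolating_parallelepiped (R : realType) (p : R) (k : nat)
    (C : boolvec k -> bool) (eps : R) (d : nat)
    (V : 'M[R]_(d, k)) (t : 'cV[R]_d) : Prop :=
  [/\ 0 <= eps,
      \rank V = k,
      forall x, C x = true -> lpnorm p (V *m bit_col R x - t) = 1
    & forall x, C x = false -> lpnorm p (V *m bit_col R x - t) = 1 + eps].

(* Total functions nat^n -> nat that are (general) recursive in the oracle phi:
   Kleene's closure of the initial functions and phi under composition,
   primitive recursion, and minimization of regular functions. *)
Inductive recursive_in (phi : nat -> nat) :
    forall n : nat, (n.-tuple nat -> nat) -> Prop :=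
| rec_oracle : recursive_in phi (fun x : 1.-tuple nat => phi (tnth x ord0))
| rec_zero : recursive_in phi (fun _ : 0.-tuple nat => 0%N)
| rec_succ : recursive_in phi (fun x : 1.-tuple nat => (tnth x ord0).+1)
| rec_proj (n : nat) (i : 'I_n) :
    recursive_in phi (fun x : n.-tuple nat => tnth x i)
| rec_comp (m n : nat) (g : m.-tuple nat -> nat)
    (h : 'I_m -> n.-tuple nat -> nat) :
    recursive_in phi g -> (forall i, recursive_in phi (h i)) ->
    recursive_in phi (fun x => g [tuple h i x | i < m])
| rec_prim (n : nat) (g : n.-tuple nat -> nat) (h : n.+2.-tuple nat -> nat)
    (f : n.+1.-tuple nat -> nat) :
    recursive_in phi g -> recursive_in phi h ->
    (forall x : n.-tuple nat, f [tuple of 0%N :: x] = g x) ->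
    (forall (y : nat) (x : n.-tuple nat), f [tuple of y.+1 :: x] =
                 h [tuple of y :: f [tuple of y :: x] :: x]) ->
    recursive_in phi f
| rec_mu (n : nat) (g : n.+1.-tuple nat -> nat) (f : n.-tuple nat -> nat) :
    recursive_in phi g ->
    (forall x, g [tuple of f x :: x] = 0%N) ->
    (forall (x : n.-tuple nat) (y : nat), (y < f x)%N -> g [tuple of y :: x] <> 0%N) ->
    recursive_in phi f.

(* phi is a name of the nonnegative real p: phi n / 2^n is within 2^-n of p. *)
Definition dyadic_name (R : realType) (p : R) (phi : nat -> nat) : Prop :=
  forall n : nat, `|2 ^+ n * p - (phi n)%:R| <= 1.

(* x is a computable real relative to p: from any name of p one can compute
   dyadic approximations (f n - g n) / 2^n of x with error at most 2^-n. *)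
Definition computable_from (R : realType) (p x : R) : Prop :=
  forall phi : nat -> nat, dyadic_name p phi ->
  exists f g : 1.-tuple nat -> nat,
    [/\ recursive_in phi f, recursive_in phi g
      & forall n : nat,
          `|2 ^+ n * x - ((f [tuple n])%:R - (g [tuple n])%:R)| <= 1].

Definition computable_parallelepiped (R : realType) (p : R) (k d : nat)
    (V : 'M[R]_(d, k)) (t : 'cV[R]_d) : Prop :=
  (forall i j, computable_from p (V i j)) /\
  (forall i, computable_from p (t i 0)).

(* The rows are indexed by u in {-1,1}^k, through an enumeration of boolvec k. *)
Definition nsigns (k : nat) : nat := #|{: boolvec k}|.

Lemma nsignsE (k : nat) : nsigns k = (2 ^ k)%N.
Proof. by rewrite /nsigns card_ffun card_bool card_ord. Qed.

Definition row_sign (R : realType) (k : nat) (i : 'I_(nsigns k)) : 'cV[R]_k :=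
  sign_col R (enum_val i).

Definition eta_exp (R : realType) (p : R) (k : nat) : int :=
  (k %/ 2)%N%:Z + Num.floor (p / 2).

Definition alpha (R : realType) (p : R) (k : nat) (b : bool)
    (u : 'cV[R]_k) : R :=
  1 + (-1) ^ (eta_exp p k + (b : nat)%:Z) * \prod_(i < k) u i 0.

Definition tstar (R : realType) (k : nat) : R := (1 + (-1) ^+ k.+1) / 2.

Definition Wmx (R : realType) (p : R) (k : nat) (b : bool) :
    'M[R]_(nsigns k, k) :=
  \matrix_(i, j) (alpha p b (row_sign R i) `^ (p^-1) * row_sign R i j 0).

Definition wvec (R : realType) (p : R) (k : nat) (b : bool) :
    'cV[R]_(nsigns k) :=
  \col_i (alpha p b (row_sign R i) `^ (p^-1) * tstar R k).

(* Main.v *)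
(* Substituting u -> u y turns |W y - w|_p^p into A + s B, where A and B are the
   plain and the parity-twisted p-th moments of (sum of k signs) - t, and the
   sign s only depends on the parity of y. With s B = -|B| on C_b^{-1}(1), the
   two values are A - |B| and A + |B|, and everything rests on the sign of B and
   on a lower bound for |B| / A.

   Counting signs, B is a multiple of sum_(1 <= i <= M) (-1)^i C(2M, M+i) i^p
   with M = ceil(k/2), which up to (2M)!/2 is the divided difference of
   y^(p/2 - 1) at the nodes a_i = 1, 4, ..., M^2. Write p/2 = n + r with n an
   integer and 0 <= r < 1. For r = 0 it vanishes. For r > 0, multiply the
   partial fraction expansion of x^n / prod (x + a_i) by x^(r-1) and integrate
   over x = e^t > 0: each summand rescales to the same integral, so that
     (+-) divided difference = J / I,
     J = int e^(pt/2) / prod (e^t + a_i) dt,  I = int e^(rt) / (1 + e^t) dt.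
   Here I <= 1 / (r (1 - r)) produces the factor |sin (pi p / 2)|, and
   prod (1 + y^2/i^2) <= exp (pi y) bounds J from below. The moment A is at most
   2^(k+1) (2 M p / e)^(p/2), by exponential moments.

   The entries are integer multiples of (N / a)^(1/p), where a is a sum of terms
   m^p with integers m, N, and rational powers of rationals are approximated by
   integer roots, which minimization finds. *)

Require Import Defs.
From HB Require Import structures.
From mathcomp Require Import all_boot all_order all_algebra.
From mathcomp Require Import all_classical all_reals all_analysis.
From mathcomp Require Import measurable_realfun qpoly.
From mathcomp Require Import zify ring lra.

Set Implicit Arguments.
Unset Strict Implicit.
Unset Printing Implicit Defensive.

Import Order.TTheory GRing.Theory Num.Theory.
Import numFieldNormedType.Exports.

Local Open Scope ring_scope.

(** * Recursive functions and computable reals *)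

Section RecursiveFunctions.
Variable phi : nat -> nat.
Local Notation rec f := (recursive_in phi f).

Lemma recursive_ext (n : nat) (f g : n.-tuple nat -> nat) :
  f =1 g -> rec f -> rec g.
Proof. by move=> /funext ->. Qed.

Lemma recursive_comp1 (n : nat) (g : nat -> nat) (f : n.-tuple nat -> nat) :
  rec (fun x : 1.-tuple nat => g (tnth x ord0)) -> rec f ->
  rec (fun x => g (f x)).
Proof.
move=> rec_g rec_f; have := @rec_comp phi 1 n _ (fun=> f) rec_g (fun=> rec_f).
by apply: recursive_ext => x; rewrite tnth_mktuple.
Qed.

Lemma recursive_comp2 (n : nat) (g : nat -> nat -> nat)
    (f1 f2 : n.-tuple nat -> nat) :
  rec (fun x : 2.-tuple nat => g (tnth x ord0) (tnth x ord_max)) ->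
  rec f1 -> rec f2 -> rec (fun x => g (f1 x) (f2 x)).
Proof.
move=> rec_g rec_f1 rec_f2.
have rec_f (i : 'I_2) : rec (if i == ord0 then f1 else f2) by case: ifP.
have := rec_comp rec_g rec_f.
by apply: recursive_ext => x; rewrite !tnth_mktuple.
Qed.

Lemma recursive_succ (n : nat) (f : n.-tuple nat -> nat) :
  rec f -> rec (fun x => (f x).+1).
Proof. exact: (recursive_comp1 (rec_succ phi)). Qed.

Lemma recursive_const (n c : nat) : rec (fun _ : n.-tuple nat => c).
Proof.
elim: c => [|c IH]; last exact: recursive_succ.
have rec_args (i : 'I_0) : rec (fun _ : n.-tuple nat => 0%N) by case: i.
exact: (rec_comp (rec_zero phi) rec_args).
Qed.

Lemma recursive_prim2 (f : nat -> nat -> nat) (g : nat -> nat)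
    (h : nat -> nat -> nat -> nat) :
  rec (fun x : 1.-tuple nat => g (tnth x ord0)) ->
  rec (fun x : 3.-tuple nat =>
         h (tnth x ord0) (tnth x (inord 1)) (tnth x ord_max)) ->
  (forall z, f 0%N z = g z) -> (forall y z, f y.+1 z = h y (f y z) z) ->
  rec (fun x : 2.-tuple nat => f (tnth x ord0) (tnth x ord_max)).
Proof.
move=> rec_g rec_h f0 fS; apply: (rec_prim rec_g rec_h) => [x|y x].
  by rewrite -f0 !(tnth_nth 0%N).
by rewrite !(tnth_nth 0%N) /= inordK //= fS.
Qed.

Lemma recursive_addn (n : nat) (f g : n.-tuple nat -> nat) :
  rec f -> rec g -> rec (fun x => f x + g x)%N.
Proof.
apply: recursive_comp2.
apply: (@recursive_prim2 addn id (fun _ r _ => r.+1)) => //.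
- exact: rec_proj.
- by apply: recursive_succ; exact: rec_proj.
Qed.

Lemma recursive_muln (n : nat) (f g : n.-tuple nat -> nat) :
  rec f -> rec g -> rec (fun x => f x * g x)%N.
Proof.
apply: recursive_comp2.
apply: (@recursive_prim2 muln (fun=> 0%N) (fun _ r z => z + r)%N) => //.
- exact: recursive_const.
- by apply: recursive_addn; exact: rec_proj.
Qed.

Lemma recursive_expn (n : nat) (f g : n.-tuple nat -> nat) :
  rec f -> rec g -> rec (fun x => f x ^ g x)%N.
Proof.
move=> rec_f rec_g; apply: (@recursive_comp2 _ (fun a b => b ^ a)%N g f) => //.
apply: (@recursive_prim2 (fun a b => b ^ a)%N (fun=> 1%N)
                         (fun _ r z => z * r)%N) => //.
- exact: recursive_const.
- by apply: recursive_muln; exact: rec_proj.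
- by move=> y z; rewrite expnS.
Qed.

Lemma recursive_predn (n : nat) (f : n.-tuple nat -> nat) :
  rec f -> rec (fun x => (f x).-1).
Proof.
move=> rec_f; apply: (@recursive_comp2 _ (fun a b => a.-1) f f) => //.
apply: (@recursive_prim2 (fun a b => a.-1) (fun=> 0%N) (fun y _ _ => y)) => //.
- exact: recursive_const.
- exact: rec_proj.
Qed.

Lemma recursive_subn (n : nat) (f g : n.-tuple nat -> nat) :
  rec f -> rec g -> rec (fun x => f x - g x)%N.
Proof.
move=> rec_f rec_g; apply: (@recursive_comp2 _ (fun a b => b - a)%N g f) => //.
apply: (@recursive_prim2 (fun a b => b - a)%N id (fun _ r _ => r.-1)) => //.
- exact: rec_proj.
- by apply: recursive_predn; exact: rec_proj.
- by move=> z; rewrite subn0.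
- by move=> y z; rewrite subnS.
Qed.

Lemma recursive_behead (n : nat) (f : n.-tuple nat -> nat) :
  rec f -> rec (fun x : n.+1.-tuple nat => f [tuple of behead x]).
Proof.
move=> rec_f.
have rec_tail (i : 'I_n) :
    rec (fun x : n.+1.-tuple nat => tnth x (lift ord0 i)).
  exact: rec_proj.
have := rec_comp rec_f rec_tail; apply: recursive_ext => x; congr f.
apply: eq_from_tnth => i; rewrite tnth_mktuple tnth_behead; congr tnth.
by apply: val_inj; rewrite /= inordK // ltnS.
Qed.

Lemma recursive_floor_root (n : nat) (a b d r : n.-tuple nat -> nat) :
  rec a -> rec b -> rec d ->
  (forall x, (r x ^ d x * b x <= a x)%N) ->
  (forall x, (a x < (r x).+1 ^ d x * b x)%N) -> rec r.
Proof.
move=> rec_a rec_b rec_d r_le r_gt.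
have rec_search : rec (fun x : n.+1.-tuple nat =>
    (a [tuple of behead x]).+1
     - (tnth x ord0).+1 ^ d [tuple of behead x] * b [tuple of behead x])%N.
  apply: recursive_subn.
    by apply: recursive_succ; exact: recursive_behead.
  apply: recursive_muln; last exact: recursive_behead.
  apply: recursive_expn; last exact: recursive_behead.
  by apply: recursive_succ; exact: rec_proj.
have beheadE y (x : n.-tuple nat) : [tuple of behead [tuple of y :: x]] = x.
  exact: val_inj.
apply: (rec_mu rec_search) => [x|x y yr]; rewrite beheadE (tnth_nth 0%N) /=.
  by apply/eqP; rewrite subn_eq0.
apply/eqP; rewrite subn_eq0 -ltnNge ltnS; apply: leq_trans (r_le x).
by rewrite leq_mul2r; apply/orP; right; case: (d x) => // e; rewrite leq_exp2r.
Qed.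

Lemma recursive_divn (n : nat) (a b : n.-tuple nat -> nat) :
  rec a -> rec b -> (forall x, 0 < b x)%N -> rec (fun x => a x %/ b x)%N.
Proof.
move=> rec_a rec_b b0.
apply: (recursive_floor_root rec_a rec_b (recursive_const n 1)) => x.
  by rewrite expn1 leq_trunc_div.
by rewrite expn1 ltn_ceil.
Qed.

End RecursiveFunctions.

Section LocalLipschitz.
Variable R : realType.

Lemma ln_le_sub1 (x : R) : 0 < x -> ln x <= x - 1.
Proof.
by move=> x0; have := @le_ln1Dx _ (x - 1); rewrite subrKC; apply; lra.
Qed.

Lemma norm_lnB_le (m x y : R) : 0 < m -> m <= x -> m <= y ->
  `|ln x - ln y| <= `|x - y| / m.
Proof.
wlog yx : x y / y <= x => [W|] m0 mx my.
  by case/orP: (le_total y x) => ?; [|rewrite distrC (distrC x)]; apply: W.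
have y0 : 0 < y by lra.
have x0 : 0 < x by lra.
rewrite !ger0_norm ?subr_ge0 ?ler_ln ?posrE // -ln_div ?posrE //.
apply: le_trans (ln_le_sub1 (divr_gt0 x0 y0)) _.
rewrite (_ : x / y - 1 = (x - y) / y); last by field; rewrite gt_eqF.
by rewrite ler_wpM2l ?subr_ge0 // lef_pV2 ?posrE.
Qed.

Lemma norm_expRB_le (x y : R) :
  `|expR x - expR y| <= expR (Num.max x y) * `|x - y|.
Proof.
wlog yx : x y / y <= x => [W|].
  by case/orP: (le_total y x) => ?; [|rewrite distrC maxC (distrC x)]; apply: W.
rewrite max_l // !ger0_norm ?subr_ge0 ?ler_expR //.
have : expR x * (1 + (y - x)) <= expR x * expR (y - x).
  by rewrite ler_pM2l ?expR_gt0 // expR_ge1Dx.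
by rewrite -expRD subrKC; lra.
Qed.

Lemma norm_invB_le (x y : R) : 0 < x -> x / 2 <= y ->
  `|x^-1 - y^-1| <= `|x - y| * (2 / x ^+ 2).
Proof.
move=> x0 xy; have y0 : 0 < y by lra.
have -> : x^-1 - y^-1 = (y - x) * (x^-1 * y^-1) by field; rewrite !gt_eqF.
rewrite normrM distrC ler_wpM2l // gtr0_norm ?mulr_gt0 ?invr_gt0 //.
rewrite expr2 invfM mulrCA ler_pM2l ?invr_gt0 //.
by rewrite -[leRHS]invf_div lef_pV2 ?posrE ?divr_gt0.
Qed.

Lemma powR_locally_lipschitz (x q : R) : 0 < x ->
  exists2 L : R, 0 <= L & forall x' q' d : R, d <= x / 2 -> d <= 1 ->
    `|x - x'| <= d -> `|q - q'| <= d -> `|x `^ q - x' `^ q'| <= L * d.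
Proof.
move=> x0; set K := `|ln x| + (`|q| + 1) * (2 / x).
have K0 : 0 <= K.
  by rewrite addr_ge0 // mulr_ge0 ?addr_ge0 // divr_ge0 // ltW.
exists (expR (`|q * ln x| + K) * K) => [|x' q' d dx d1 xx' qq'].
  by rewrite mulr_ge0 ?expR_ge0.
have x'x : x / 2 <= x' by move: xx'; rewrite ler_norml; lra.
have q'_le : `|q'| <= `|q| + 1.
  by have := ler_distD q q' 0; rewrite !subr0 distrC; lra.
have ln_near : `|ln x - ln x'| <= 2 / x * d.
  apply: le_trans (norm_lnB_le _ _ x'x) _; [lra..|].
  by rewrite invf_div mulrC ler_wpM2l // divr_ge0 // ltW.
have exponent_near : `|q * ln x - q' * ln x'| <= K * d.
  have -> : q * ln x - q' * ln x' =
      (q - q') * ln x + q' * (ln x - ln x') by ring.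
  apply: le_trans (ler_normD _ _) _; rewrite !normrM mulrDl lerD //.
    by rewrite mulrC ler_wpM2l.
  by rewrite -mulrA; apply: ler_pM.
have x'0 : 0 < x' by lra.
rewrite /powR !gt_eqF //.
apply: le_trans (norm_expRB_le _ _) _.
rewrite -mulrA; apply: ler_pM => //; rewrite ler_expR ge_max.
have Kd : K * d <= K by rewrite ler_piMr.
have := ler_norm (q * ln x); move: exponent_near; rewrite ler_norml.
by move=> /andP[? ?] ?; apply/andP; split; lra.
Qed.

End LocalLipschitz.

Section ApproximableReals.
Variables (R : realType) (phi : nat -> nat).
Local Notation rec1 f :=
  (recursive_in phi (fun x : 1.-tuple nat => f (tnth x ord0))).

(* C need not be computable: it only costs a shift of n. *)
Definition approximable (x : R) : Prop :=
  exists (N D : nat -> nat) (C : R),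
    [/\ rec1 N, rec1 D, forall n, (0 < D n)%N
      & forall n, `|x - (N n)%:R / (D n)%:R| <= C / 2 ^+ n].

Lemma recursive_exp2 : rec1 (fun n => 2 ^ n)%N.
Proof. by apply: recursive_expn; [exact: recursive_const|exact: rec_proj]. Qed.

Lemma recursive_shift (f : nat -> nat) (s : nat) :
  rec1 f -> rec1 (fun n => f (n + s)%N).
Proof.
move=> rec_f; apply: (recursive_comp1 rec_f).
by apply: recursive_addn; [exact: rec_proj|exact: recursive_const].
Qed.

Lemma approximable_eventually (x : R) (N D : nat -> nat) (C : R) (n0 : nat) :
  rec1 N -> rec1 D -> (forall n, (n0 <= n)%N -> (0 < D n)%N) ->
  (forall n, (n0 <= n)%N -> `|x - (N n)%:R / (D n)%:R| <= C / 2 ^+ n) ->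
  approximable x.
Proof.
move=> rec_N rec_D D0 near_x.
exists (fun n => N (n + n0)%N), (fun n => D (n + n0)%N), C; split.
- exact: recursive_shift.
- exact: recursive_shift.
- by move=> n; rewrite D0 // leq_addl.
- move=> n; apply: le_trans (near_x _ (leq_addl _ _)) _.
  have C0 : 0 <= C.
    have := le_trans (normr_ge0 _) (near_x _ (leqnn n0)).
    by rewrite pmulr_lge0 // invr_gt0 exprn_gt0.
  rewrite ler_wpM2l // lef_pV2 ?posrE ?exprn_gt0 //.
  by rewrite ler_weXn2l ?ler1n // leq_addr.
Qed.

Lemma approximable_nat (c : nat) : approximable c%:R.
Proof.
exists (fun=> c), (fun=> 1%N), 0; split => //; try exact: recursive_const.
by move=> n; rewrite mul0r divr1 subrr normr0.
Qed.

Lemma approximable_name (p : R) : dyadic_name p phi -> approximable p.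
Proof.
move=> phi_p; exists phi, (fun n => 2 ^ n)%N, 1; split.
- exact: rec_oracle.
- exact: recursive_exp2.
- by move=> n; rewrite expn_gt0.
- move=> n; rewrite natrX ler_pdivlMr ?exprn_gt0 //.
  rewrite -{2}(@gtr0_norm _ (2 ^+ n)) ?exprn_gt0 // -normrM mulrBl.
  by rewrite divfK ?expf_neq0 // mulrC phi_p.
Qed.

Lemma approximable_add (x y : R) :
  approximable x -> approximable y -> approximable (x + y).
Proof.
move=> [N [D [C [rN rD D0 xND]]]] [N' [D' [C' [rN' rD' D'0 yND']]]].
exists (fun n => N n * D' n + N' n * D n)%N, (fun n => D n * D' n)%N, (C + C').
split.
- by apply: recursive_addn; apply: recursive_muln.
- exact: recursive_muln.
- by move=> n; rewrite muln_gt0 D0 D'0.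
- move=> n; have Dn : (D n)%:R != 0 :> R by rewrite pnatr_eq0 -lt0n.
  have D'n : (D' n)%:R != 0 :> R by rewrite pnatr_eq0 -lt0n.
  rewrite natrD !natrM -addf_div // opprD addrACA mulrDl.
  by apply: le_trans (ler_normD _ _) _; rewrite lerD.
Qed.

Lemma approximable_natM (c : nat) (x : R) :
  approximable x -> approximable (c%:R * x).
Proof.
move=> [N [D [C [rN rD D0 xND]]]].
exists (fun n => c * N n)%N, D, (c%:R * C); split => //.
- by apply: recursive_muln => //; exact: recursive_const.
- move=> n; rewrite natrM -!mulrA -mulrBr normrM normr_nat.
  by rewrite ler_wpM2l.
Qed.

Lemma approximable_sum (I : finType) (F : I -> R) :
  (forall i, approximable (F i)) -> approximable (\sum_i F i).
Proof.
move=> approxF; apply: big_ind => //; first exact: (approximable_nat 0).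
exact: approximable_add.
Qed.

Lemma div_exp2_le (C y : R) (n : nat) : 0 < y ->
  (Num.bound (C / y) <= n)%N -> C / 2 ^+ n <= y.
Proof.
move=> y0 /upper_nthrootP C2n.
by rewrite ler_pdivrMr ?exprn_gt0 // mulrC -ler_pdivrMr // ltW.
Qed.

Lemma approximable_inv (x : R) : 0 < x -> approximable x -> approximable x^-1.
Proof.
move=> x0 [N [D [C [rN rD D0 xND]]]].
pose n0 := Num.bound (C / (x / 2)).
pose A n : R := (N n)%:R / (D n)%:R.
have A_ge n : (n0 <= n)%N -> x / 2 <= A n.
  move=> /(div_exp2_le (divr_gt0 x0 (ltr0Sn _ _))) C_le.
  by have := le_trans (xND n) C_le; rewrite ler_norml -/(A n); lra.
have N0 n : (n0 <= n)%N -> (0 < N n)%N.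
  by move=> /A_ge; rewrite /A; case: (N n) => // ; rewrite mul0r; lra.
apply: (@approximable_eventually _ D N (C * (2 / x ^+ 2)) n0) => // n le_n.
rewrite -(invf_div (N n)%:R); apply: le_trans (norm_invB_le x0 (A_ge n le_n)) _.
rewrite mulrAC ler_wpM2r //; first by rewrite divr_ge0 ?exprn_ge0 // ltW.
exact: xND.
Qed.

Lemma recursive_truncn_powR (N D N' D' : nat -> nat) :
  rec1 N -> rec1 D -> rec1 N' -> rec1 D' ->
  (forall n, 0 < D n)%N -> (forall n, 0 < D' n)%N ->
  rec1 (fun n => Num.truncn
    (2 ^+ n * ((N n)%:R / (D n)%:R) `^ ((N' n)%:R / (D' n)%:R) : R)).
Proof.
move=> rN rD rN' rD' D0 D'0.
pose v n : R := 2 ^+ n * ((N n)%:R / (D n)%:R) `^ ((N' n)%:R / (D' n)%:R).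
have v0 n : 0 <= v n by rewrite mulr_ge0 ?exprn_ge0 ?powR_ge0.
have vX n : v n ^+ D' n * (D n ^ N' n)%:R = ((2 ^ n) ^ D' n * N n ^ N' n)%:R.
  have Dn : (D n)%:R != 0 :> R by rewrite pnatr_eq0 -lt0n.
  have D'n : (D' n)%:R != 0 :> R by rewrite pnatr_eq0 -lt0n.
  rewrite exprMn -[X in _ * X * _]powR_mulrn ?powR_ge0 // -powRrM divfK //.
  rewrite powR_mulrn ?divr_ge0 // expr_div_n natrM !natrX -mulrA divfK //.
  by rewrite expf_neq0.
apply: (@recursive_floor_root phi 1
  (fun x => (2 ^ tnth x ord0) ^ D' (tnth x ord0)
            * N (tnth x ord0) ^ N' (tnth x ord0))%N
  (fun x => D (tnth x ord0) ^ N' (tnth x ord0))%N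
  (fun x => D' (tnth x ord0))).
- apply: recursive_muln; apply: recursive_expn => //.
  exact: recursive_exp2.
- exact: recursive_expn.
- by [].
- move=> x; set n := tnth x ord0; have /andP[v_ge _] := truncn_itv (v0 n).
  by rewrite -(ler_nat R) -vX natrM natrX ler_wpM2r // lerXn2r ?nnegrE.
- move=> x; set n := tnth x ord0; have /andP[_ v_lt] := truncn_itv (v0 n).
  rewrite -(ltr_nat R) -vX natrM ltr_pM2r ?ltr0n ?expn_gt0 ?D0 //.
  by rewrite natrX ltr_pXn2r ?nnegrE.
Qed.

Lemma dist_truncn_exp2 (y : R) (n : nat) : 0 <= y ->
  `|y - (Num.truncn (2 ^+ n * y))%:R / 2 ^+ n| <= 1 / 2 ^+ n.
Proof.
move=> y0; have p2 : 0 < 2 ^+ n :> R by rewrite exprn_gt0.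
have /andP[] := truncn_itv (mulr_ge0 (ltW p2) y0); set r := Num.truncn _.
rewrite -natr1 => r_le r_gt.
have -> : y - r%:R / 2 ^+ n = (2 ^+ n * y - r%:R) / 2 ^+ n.
  by rewrite mulrBl mulrAC divff ?mul1r ?gt_eqF.
rewrite normrM (gtr0_norm (_ : 0 < _^-1)) ?invr_gt0 // ler_pM2r ?invr_gt0 //.
by rewrite ger0_norm ?subr_ge0 //; lra.
Qed.

Lemma approximable_powR (x q : R) :
  0 < x -> approximable x -> approximable q -> approximable (x `^ q).
Proof.
move=> x0 [N [D [C [rN rD D0 xND]]]] [N' [D' [C' [rN' rD' D'0 qND']]]].
have [L L0 powR_near] := powR_locally_lipschitz q x0.
pose E := Num.max C C'; pose m := Num.min (x / 2) 1.
have m0 : 0 < m by rewrite lt_min divr_gt0 //=.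
have rec_root := recursive_truncn_powR rN rD rN' rD' D0 D'0.
apply: (approximable_eventually (C := L * E + 1) (n0 := Num.bound (E / m))
  rec_root recursive_exp2) => [n _|n /(div_exp2_le m0)].
  by rewrite expn_gt0.
rewrite le_min => /andP[E_le_x E_le1].
have x_near : `|x - (N n)%:R / (D n)%:R| <= E / 2 ^+ n.
  by apply: le_trans (xND n) _; rewrite ler_pM2r ?invr_gt0 // le_max lexx.
have q_near : `|q - (N' n)%:R / (D' n)%:R| <= E / 2 ^+ n.
  by apply: le_trans (qND' n) _; rewrite ler_pM2r ?invr_gt0 // le_max lexx orbT.
have := powR_near _ _ _ E_le_x E_le1 x_near q_near.
set P := (_ / _) `^ _ => P_near; rewrite natrX.
apply: le_trans (ler_distD P _ _) _; rewrite mulrDl -mulrA lerD //.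
exact: dist_truncn_exp2 (powR_ge0 _ _).
Qed.

Lemma dist_round_divn (a d : nat) : (0 < d)%N ->
  `|a%:R / d%:R - ((2 * a + d) %/ (2 * d))%N%:R| <= 1 / 2 :> R.
Proof.
move=> d0; set r := (_ %/ _)%N; have dR : 0 < d%:R :> R by rewrite ltr0n.
have d2 : (0 < 2 * d)%N by rewrite muln_gt0.
have r_le : (r * (2 * d) <= 2 * a + d)%N by exact: leq_trunc_div.
have r_gt : (2 * a + d < r.+1 * (2 * d))%N by exact: ltn_ceil.
have aE : 2 * a%:R + d%:R = (a%:R / d%:R + 1 / 2) * (2 * d%:R) :> R.
  by field; rewrite gt_eqF.
move: r_le; rewrite -(ler_nat R) natrD !natrM aE ler_pM2r ?mulr_gt0 // => r_le.
move: r_gt; rewrite -(ltr_nat R) natrD !natrM aE ltr_pM2r ?mulr_gt0 //.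
by rewrite -[r.+1%:R]natr1 => r_gt; rewrite ler_norml; lra.
Qed.

Lemma approximable_round (x : R) : approximable x ->
  exists2 f : nat -> nat, rec1 f & forall n, `|2 ^+ n * x - (f n)%:R| <= 1.
Proof.
move=> [N [D [C [rN rD D0 xND]]]]; pose s := Num.bound (C / (1 / 2)).
exists (fun n => (2 * (2 ^ n * N (n + s)) + D (n + s)) %/ (2 * D (n + s)))%N.
  have rNs := recursive_shift s rN; have rDs := recursive_shift s rD.
  apply: recursive_divn => [||y]; last by rewrite muln_gt0 D0.
    apply: recursive_addn => //.
    apply: recursive_muln; first exact: recursive_const.
    by apply: recursive_muln => //; exact: recursive_exp2.
  by apply: recursive_muln => //; exact: recursive_const.
move=> n; set A := (2 ^ n * N (n + s))%N.
apply: le_trans (ler_distD (A%:R / (D (n + s)%N)%:R) _ _) _.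
apply: (@le_trans _ _ (1 / 2 + 1 / 2)); last by lra.
apply: lerD; last exact: dist_round_divn.
rewrite natrM natrX -mulrA -mulrBr normrM gtr0_norm ?exprn_gt0 //.
apply: le_trans (ler_wpM2l _ (xND _)) _; rewrite ?exprn_ge0 //.
have -> : 2 ^+ n * (C / 2 ^+ (n + s)) = C / 2 ^+ s.
  by rewrite exprD; field; rewrite !gt_eqF ?exprn_gt0.
by apply: div_exp2_le => //; rewrite divr_gt0.
Qed.

End ApproximableReals.

Lemma computable_from_intM (R : realType) (p x : R) (z : int) :
  (forall phi, dyadic_name p phi -> approximable phi x) ->
  computable_from p (z%:~R * x).
Proof.
move=> approx_x phi phi_p.
have [f rec_f f_near] :=
  approximable_round (approximable_natM `|z|%N (approx_x phi phi_p)).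
have rec0 : recursive_in phi (fun _ : 1.-tuple nat => 0%N).
  exact: recursive_const.
case: (intP z) f_near => [|m|m] f_near.
- exists (fun=> 0%N), (fun=> 0%N); split=> // n.
  by rewrite mul0r mulr0 !subr0 normr0.
- exists (fun y => f (tnth y ord0)), (fun=> 0%N); split=> // n.
  by rewrite subr0 (tnth_nth 0%N); exact: f_near.
- exists (fun=> 0%N), (fun y => f (tnth y ord0)); split=> // n.
  rewrite sub0r mulrNz mulNr mulrN -normrN opprB addrC opprK (tnth_nth 0%N).
  exact: f_near.
Qed.

(** * Elementary inequalities *)

Section ElementaryInequalities.
Local Open Scope classical_set_scope.
Variable R : realType.

Lemma is_derive_MVT (f df : R -> R) (x y : R) : x <= y ->
  (forall t : R, is_derive t 1 f (df t)) ->
  exists2 c, x <= c <= y & f y - f x = df c * (y - x).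
Proof.
move=> xy f_df; have cf : {within `[x, y], continuous f}.
  by apply: derivable_within_continuous => t _; exact: ex_derive.
have [c] := MVT_segment xy (fun t _ => f_df t) cf.
by rewrite in_itv /=; exists c.
Qed.

Lemma atanB_ge (x y : R) : 0 <= x -> x <= y ->
  (y - x) / (1 + y ^+ 2) <= atan y - atan x.
Proof.
move=> x0 xy; have [c /andP[xc cy] ->] := is_derive_MVT xy (@is_derive1_atan R).
rewrite mulrC ler_wpM2r ?subr_ge0 // lef_pV2 ?posrE ?ltr_pwDl ?sqr_ge0 //.
by rewrite lerD2l lerXn2r // nnegrE (le_trans x0) // (le_trans xc).
Qed.

Lemma sum_poisson_kernel_le (M : nat) (s : R) : 0 < s ->
  \sum_(i < M) s / (i.+1%:R ^+ 2 + s ^+ 2) <= pi / 2.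
Proof.
move=> s0; pose step (i : nat) : R := atan (i.+1%:R / s) - atan (i%:R / s).
apply: (@le_trans _ _ (\sum_(i < M) step i)).
  apply: ler_sum => i _.
  have i_ge0 : 0 <= i%:R / s by rewrite divr_ge0 // ltW.
  have i_le : i%:R / s <= i.+1%:R / s by rewrite ler_pM2r ?invr_gt0 // ler_nat.
  have := atanB_ge i_ge0 i_le; congr (_ <= _); rewrite -[i.+1%:R]natr1.
  by field; rewrite !gt_eqF // ltr_wpDl ?sqr_ge0 ?exprn_gt0.
rewrite -(big_mkord xpredT step).
by rewrite telescope_sumr // mul0r atan0 subr0 ltW // atan_ltpi2.
Qed.

Lemma prod_1Dsqr_le_expR (M : nat) (y : R) : 0 <= y ->
  \prod_(i < M) (1 + (y / i.+1%:R) ^+ 2) <= expR (pi * y).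
Proof.
move=> y0.
have factor_gt0 (i : 'I_M) (s : R) : 0 < 1 + (s / i.+1%:R) ^+ 2.
  by rewrite ltr_pwDl // sqr_ge0.
pose f (s : R) : R := \sum_(i < M) ln (1 + (s / i.+1%:R) ^+ 2).
pose df (s : R) : R := \sum_(i < M) 2 * (s / (i.+1%:R ^+ 2 + s ^+ 2)).
have f_df (s : R) : is_derive s 1 f (df s).
  have -> : f = \sum_(i < M) (fun s => ln (1 + (s / i.+1%:R) ^+ 2)).
    by apply/funext => t; rewrite fct_sumE.
  apply: is_derive_sum => i.
  have ln_derive := is_derive1_ln (factor_gt0 i s).
  apply: is_derive_eq.
  have denominator_gt0 : 0 < i.+1%:R ^+ 2 + s ^+ 2 :> R.
    by rewrite ltr_pwDl ?sqr_ge0 ?exprn_gt0.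
  by rewrite /GRing.scale /=; field; rewrite nat1r !gt_eqF.
have [c /andP[c0 _]] := is_derive_MVT y0 f_df.
rewrite {2}/f big1 ?subr0 => [fE|i _]; last by rewrite mul0r expr0n addr0 ln1.
have -> : \prod_(i < M) (1 + (y / i.+1%:R) ^+ 2) = expR (f y).
  by rewrite expR_sum; apply: eq_bigr => i _; rewrite lnK ?posrE.
rewrite ler_expR fE ler_wpM2r // /df -mulr_sumr.
have [->|c_neq0] := eqVneq c 0.
  by rewrite big1 ?mulr0 ?pi_ge0 // => i _; rewrite mul0r.
have c_gt0 : 0 < c by rewrite lt_def c_neq0.
by have := sum_poisson_kernel_le M c_gt0; lra.
Qed.

Lemma sin_le_id (x : R) : 0 <= x -> sin x <= x.
Proof.
move=> x0; have [c _] := is_derive_MVT x0 (@is_derive_sin R).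
by rewrite sin0 !subr0 => ->; rewrite ler_piMl // cos_le1.
Qed.

Lemma norm_sin_piM_le (n : nat) (r : R) : 0 <= r <= 1 ->
  `|sin (pi * (n%:R + r))| <= 2 * pi * (r * (1 - r)).
Proof.
move=> /andP[r0 r1]; have pi0 := pi_gt0 R.
have -> : pi * (n%:R + r) = pi * r + pi *+ n by rewrite -mulr_natr; ring.
rewrite (alternatingn (@sinDpi R)) normrM normrX normrN1 expr1n mul1r.
have x0 : 0 <= pi * r by rewrite mulr_ge0 // ltW.
have x1 : 0 <= pi * (1 - r) by rewrite mulr_ge0 ?subr_ge0 // ltW.
have sin_sym : sin (pi * (1 - r)) = sin (pi * r).
  by rewrite mulrBr mulr1 sinB sinpi cospi; ring.
rewrite ger0_norm; last by apply: sin_ge0_pi; rewrite x0 /=; lra.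
have [r_le|r_gt] := leP r (1 / 2).
  by apply: le_trans (sin_le_id x0) _; nra.
by rewrite -sin_sym; apply: le_trans (sin_le_id x1) _; nra.
Qed.

End ElementaryInequalities.

(** * Exponential integrals *)

Section ExponentialIntegrals.
Local Open Scope classical_set_scope.
Variable R : realType.
Local Notation mu := (@lebesgue_measure R).

Lemma continuous_expRM (c : R) : continuous (fun t : R => expR (c * t)).
Proof.
move=> t; apply: differentiable_continuous; apply/derivable1_diffP.
exact: ex_derive.
Qed.

Lemma measurable_expRM (c : R) (A : set R) :
  measurable_fun A (fun t => expR (c * t)).
Proof.
apply: measurable_funTS; apply: continuous_measurable_fun.
exact: continuous_expRM.
Qed.

Lemma integral_expR_itvy (c w : R) : 0 < c ->
  (\int[mu]_(t in `[w, +oo[) (expR (- c * t))%:E = (expR (- c * w) / c)%:E)%E.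
Proof.
move=> c0; pose F (t : R) : R := - (expR (- c * t) / c).
have dF (t : R) : is_derive t 1 F (expR (- c * t)).
  by apply: is_derive_eq; rewrite /GRing.scale /=; field; rewrite gt_eqF.
have cF : continuous F.
  by move=> t; apply: differentiable_continuous; apply/derivable1_diffP.
rewrite (@ge0_continuous_FTC2y _ _ F _ 0) //.
- by rewrite sub0e -EFinN opprK.
- by apply: continuous_subspaceT; exact: continuous_expRM.
- rewrite -oppr0 -[X in - X](mul0r c^-1); apply: cvgN; apply: cvgMl.
  under eq_fun do rewrite mulNr.
  by apply: (cvg_comp _ _ _ (@cvgr_expR R)); exact: gt0_cvgMry.
- by apply: cvg_at_right_filter; exact: cF.
- by move=> t _; rewrite derive1E; exact: derive_val.
Qed.

Lemma integral_expR_itvNy (c w : R) : 0 < c ->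
  (\int[mu]_(t in `]-oo, w]) (expR (c * t))%:E = (expR (c * w) / c)%:E)%E.
Proof.
move=> c0; rewrite -{1}[w]opprK ge0_integration_by_substitutionNy.
- rewrite -(mulrNN c w) -integral_expR_itvy //.
  by apply: eq_integral => t _ /=; rewrite mulrN mulNr.
- by apply: continuous_subspaceT; exact: continuous_expRM.
- by move=> t _; exact: expR_ge0.
Qed.

Lemma ge0_integral_subr (f : R -> R) (c : R) : continuous f ->
  (forall t, 0 <= f t) ->
  (\int[mu]_t (f (t - c))%:E = \int[mu]_t (f t)%:E)%E.
Proof.
move=> cf f0; pose F (t : R) : R := t - c.
have dF (t : R) : is_derive t 1 F 1 by apply: is_derive_eq; rewrite subr0.
have F1 : F^`() = cst 1.
  by apply/funext => t; rewrite derive1E; exact: derive_val.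
rewrite [RHS](@increasing_ge0_integration_by_substitutionT _ F) // ?F1.
- by apply: eq_integral => t _ /=; rewrite fctE mulr1.
- by move=> x y; rewrite ltrD2r.
- exact: cst_continuous.
- exact: is_cvg_cst.
- exact: is_cvg_cst.
- exact: cvg_addrr_Ny.
- exact: cvg_addrr.
Qed.

Definition logistic_kernel (r t : R) : R := expR (r * t) / (1 + expR t).

Lemma logistic_kernel_ge0 (r t : R) : 0 <= logistic_kernel r t.
Proof. by rewrite divr_ge0 ?addr_ge0 ?expR_ge0. Qed.

Lemma continuous_logistic_kernel (r : R) : continuous (logistic_kernel r).
Proof.
move=> t; apply: (@continuousM _ _ (fun t => expR (r * t))
  (fun t => (1 + expR t)^-1)); first exact: continuous_expRM.
apply: continuousV; first by rewrite gt_eqF // ltr_wpDl // expR_gt0.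
by apply: cvgD; [exact: cvg_cst|exact: continuous_expR].
Qed.

Lemma measurable_logistic_kernel (r : R) (A : set R) :
  measurable_fun A (logistic_kernel r).
Proof.
apply: measurable_funTS; apply: continuous_measurable_fun.
exact: continuous_logistic_kernel.
Qed.

Lemma integral_logistic_kernel_ge0 (r : R) :
  (0 <= \int[mu]_t (logistic_kernel r t)%:E)%E.
Proof.
by apply: integral_ge0 => t _; rewrite lee_fin logistic_kernel_ge0.
Qed.

Lemma integral_logistic_kernel_le (r : R) : 0 < r -> r < 1 ->
  (\int[mu]_t (logistic_kernel r t)%:E <= (r * (1 - r))^-1%:E)%E.
Proof.
move=> r0 r1; have c0 : 0 < 1 - r by rewrite subr_gt0.
rewrite -(setUv `]-oo, 0]) ge0_integral_setU //=; last 4 first.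
- exact: measurableC.
- by apply/measurable_EFinP; exact: measurable_logistic_kernel.
- by move=> t _; rewrite lee_fin logistic_kernel_ge0.
- exact/disj_setPCl.
rewrite setCitvl integral_itv_obnd_cbnd; last first.
  by apply/measurable_EFinP; exact: measurable_logistic_kernel.
have -> : ((r * (1 - r))^-1%:E = \int[mu]_(t in `]-oo, 0%R]) (expR (r * t))%:E +
    \int[mu]_(t in `[0%R, +oo[) (expR (- (1 - r) * t))%:E)%E.
  rewrite integral_expR_itvNy // integral_expR_itvy // !mulr0 expR0 -EFinD.
  by congr (_%:E); field; rewrite !gt_eqF.
apply: leeD; (apply: ge0_le_integral => //=;
  [|by apply/measurable_EFinP; exact: measurable_logistic_kernel
   |by apply/measurable_EFinP; exact: measurable_expRM|]) => t _;
  rewrite lee_fin ?logistic_kernel_ge0 // ler_pdivrMr ?ltr_wpDl ?expR_gt0 //.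
- by rewrite ler_peMr ?expR_ge0 // lerDl expR_ge0.
- rewrite mulrDr mulr1 -expRD (_ : - (1 - r) * t + t = r * t); last by ring.
  by rewrite lerDr expR_ge0.
Qed.

Lemma integrable_logistic_kernel (r c : R) : 0 < r -> r < 1 ->
  mu.-integrable setT (fun t => (logistic_kernel r (t - c))%:E).
Proof.
move=> r0 r1; apply/integrableP; split.
  apply/measurable_EFinP; apply: continuous_measurable_fun => t.
  apply: (@continuous_comp _ _ _ (fun t => t - c) (logistic_kernel r)).
    by apply: cvgB; [exact: cvg_id|exact: cvg_cst].
  exact: continuous_logistic_kernel.
under eq_integral do rewrite gee0_abs ?lee_fin ?logistic_kernel_ge0 //.
rewrite (ge0_integral_subr _ (@continuous_logistic_kernel r)).
  exact: le_lt_trans (integral_logistic_kernel_le r0 r1) (ltry _).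
exact: logistic_kernel_ge0.
Qed.

End ExponentialIntegrals.

(** * Divided differences of powers *)

Section DividedDifferences.
Variables (F : fieldType) (a : nat -> F).

Definition divdiff (n : nat) (f : F -> F) : F :=
  \sum_(i < n) f (a i) / \prod_(l < n | l != i) (a i - a l).

Lemma horner_prod_XsubC (I : finType) (P : pred I) (b : I -> F) (x : F) :
  (\prod_(i | P i) ('X - (b i)%:P)).[x] = \prod_(i | P i) (x - b i).
Proof. by rewrite horner_prod; apply: eq_bigr => i _; rewrite hornerXsubC. Qed.

Lemma divdiff_partial_fractions (n : nat) (p : {poly F}) (x : F) :
  injective a -> (size p <= n)%N -> (forall i, x != a i) ->
  divdiff n (fun y => p.[y] / (x - y)) = p.[x] / \prod_(i < n) (x - a i).
Proof.
move=> inj_a sz_p xa; have [p0|n0] := posnP n.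
  move: sz_p; rewrite p0 leqn0 size_poly_eq0 => /eqP ->.
  by rewrite horner0 mul0r /divdiff big_ord0.
rewrite [p in RHS](lagrange_gen n0 inj_a) // horner_sum mulr_suml.
apply: eq_bigr => i _.
rewrite lagrangeE // !hornerM !hornerC !horner_prod_XsubC.
rewrite [X in _ = _ / X](bigD1 i) //=.
have Q0 : \prod_(l < n | l != i) (x - a l) != 0.
  by apply/prodf_neq0 => l _; rewrite subr_eq0.
have P0 : \prod_(l < n | l != i) (a i - a l) != 0.
  by apply/prodf_neq0 => l li; rewrite subr_eq0 (inj_eq inj_a) eq_sym.
by field; rewrite P0 Q0 subr_eq0 xa.
Qed.

Lemma divdiff_horner (n : nat) (p : {poly F}) :
  injective a -> (size p <= n.+1)%N -> divdiff n.+1 (horner p) = p`_n.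
Proof.
move=> inj_a sz_p.
rewrite [p in RHS](lagrange_gen (ltn0Sn n) inj_a) // coef_sum.
apply: eq_bigr => i _; rewrite lagrangeE // !coefCM horner_prod_XsubC.
set q := \prod_(l < n.+1 | _) ('X - _); suff -> : q`_n = 1 by rewrite mulr1.
have sz_q : size q = n.+1.
  rewrite /q -big_filter size_prod_XsubC size_filter -sum1_count.
  by rewrite (eq_bigl (mem (predC1 i))) // sum1_card cardC1 card_ord.
have /monicP : q \is monic by rewrite rpred_prod // => l _; exact: monicXsubC.
by rewrite lead_coefE sz_q.
Qed.

End DividedDifferences.

Section DividedDifferencePowers.
Local Open Scope classical_set_scope.
Variables (R : realType) (a : nat -> R).
Hypotheses (a_gt0 : forall i, 0 < a i) (inj_a : injective a).
Local Notation mu := (@lebesgue_measure R).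

Lemma exp_partial_fractions (M n : nat) (r t : R) : (n < M)%N ->
  expR ((n%:R + r) * t) / \prod_(i < M) (expR t + a i) =
  \sum_(i < M) (-1) ^+ (n + M.+1) *
    (a i `^ (n%:R + r - 1) / \prod_(l < M | l != i) (a i - a l)) *
    logistic_kernel r (t - ln (a i)).
Proof.
move=> nM; set x := expR t; have x0 : 0 < x by exact: expR_gt0.
have Nx_neq_a i : - x != a i.
  by rewrite lt_eqF // (lt_trans _ (a_gt0 i)) // oppr_lt0.
have sz_Xn : (size ('X^n : {poly R}) <= M)%N by rewrite size_polyXn.
have := divdiff_partial_fractions inj_a sz_Xn Nx_neq_a; rewrite hornerXn => pf.
have -> : \prod_(i < M) (x + a i) = (-1) ^+ M * \prod_(i < M) (- x - a i).
  rewrite -[X in _ ^+ X]card_ord -prodr_const -big_split /=.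
  by apply: eq_bigr => i _; rewrite mulN1r opprB opprK addrC.
have -> : expR ((n%:R + r) * t) = expR (r * t) * ((-1) ^+ n * (- x) ^+ n).
  rewrite -exprMn mulN1r opprK mulrDl expRD mulrC; congr (_ * _).
  by rewrite expRM_natl.
transitivity ((-1) ^+ (n + M) *
    (expR (r * t) * ((- x) ^+ n / \prod_(i < M) (- x - a i)))).
  by rewrite invfM invr_sign exprD; ring.
rewrite -pf /divdiff !mulr_sumr; apply: eq_bigr => i _.
rewrite addnS exprS mulN1r !mulNr -mulrN -mulrA; congr (_ * _).
set P := \prod_(l < M | l != i) _; have ai := a_gt0 i.
have aE : (a i) `^ (n%:R + r - 1) = a i ^+ n * expR (r * ln (a i)) / a i.
  rewrite /powR gt_eqF // mulrBl mulrDl mul1r expRB expRD lnK ?posrE //.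
  by rewrite expRM_natl lnK ?posrE.
rewrite hornerXn aE /logistic_kernel mulrBr !expRB lnK ?posrE // -/x.
have er := expR_gt0 (r * ln (a i)); have xa : 0 < x + a i by rewrite addr_gt0.
have -> : - x - a i = - (x + a i) by rewrite opprD.
rewrite invrN; move: P^-1 => P'.
by field; rewrite !gt_eqF // addrC.
Qed.

Lemma integrable_exp_div_prod (M n : nat) (r : R) :
  (n < M)%N -> 0 < r -> r < 1 ->
  mu.-integrable setT
    (fun t => (expR ((n%:R + r) * t) / \prod_(i < M) (expR t + a i))%:E).
Proof.
move=> nM r0 r1; under eq_fun do rewrite exp_partial_fractions // -sumEFin.
apply: integrable_sum => // i _; under eq_fun do rewrite EFinM.
by apply: integrableZl => //; exact: integrable_logistic_kernel.
Qed.

Lemma integral_exp_div_prod (M n : nat) (r : R) : (n < M)%N -> 0 < r -> r < 1 ->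
  (\int[mu]_t (expR ((n%:R + r) * t) / \prod_(i < M) (expR t + a i))%:E =
   ((-1) ^+ (n + M.+1) * divdiff a M (fun y => y `^ (n%:R + r - 1)))%:E *
   \int[mu]_t (logistic_kernel r t)%:E)%E.
Proof.
move=> nM r0 r1; set G := (\int[mu]_t (logistic_kernel r t)%:E)%E.
have G_fin : G \is a fin_num.
  rewrite ge0_fin_numE ?integral_logistic_kernel_ge0 //.
  exact: le_lt_trans (integral_logistic_kernel_le r0 r1) (ltry _).
under eq_integral do rewrite exp_partial_fractions // -sumEFin.
have kernel_int (i : 'I_M) :
    mu.-integrable setT (fun t => (logistic_kernel r (t - ln (a i)))%:E).
  exact: integrable_logistic_kernel.
rewrite integral_sum // => [|i]; last first.
  by under eq_fun do rewrite EFinM; apply: integrableZl.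
rewrite -(fineK G_fin) -EFinM mulr_sumr mulr_suml -sumEFin.
apply: eq_bigr => i _.
under eq_integral do rewrite EFinM.
rewrite integralZl // (ge0_integral_subr _ (@continuous_logistic_kernel _ r)).
  by rewrite -/G -(fineK G_fin) -EFinM.
exact: logistic_kernel_ge0.
Qed.

Lemma integral_exp_div_prod_ge (M : nat) (s y : R) : 0 < s -> 0 < y ->
  mu.-integrable setT
    (fun t => (expR (s * t) / \prod_(i < M) (expR t + a i))%:E) ->
  ((y `^ s / (s * \prod_(i < M) (y + a i)))%:E <=
   \int[mu]_t (expR (s * t) / \prod_(i < M) (expR t + a i))%:E)%E.
Proof.
move=> s0 y0 /measurable_int h_measurable.
have prod_gt0 (x : R) : 0 < x -> 0 < \prod_(i < M) (x + a i).
  by move=> x0; apply: prodr_gt0 => i _; rewrite addr_gt0.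
set P := \prod_(i < M) (y + a i); have P0 : 0 < P by exact: prod_gt0.
have -> : y `^ s / (s * P) = P^-1 * (expR (s * ln y) / s).
  by rewrite /powR gt_eqF // invfM; ring.
apply: (@le_trans _ _ (\int[mu]_(t in `]-oo, ln y])
    (expR (s * t) / \prod_(i < M) (expR t + a i))%:E)%E); last first.
  apply: ge0_subset_integral => // t _; rewrite lee_fin.
  by rewrite divr_ge0 ?expR_ge0 // ltW ?prod_gt0 ?expR_gt0.
rewrite EFinM -integral_expR_itvNy // -ge0_integralZl_EFin //; first last.
- by rewrite invr_ge0 ltW.
- by apply/measurable_EFinP; exact: measurable_expRM.
apply: ge0_le_integral => //=.
- by move=> t _; rewrite lee_fin mulr_ge0 ?expR_ge0 // invr_ge0 ltW.
- apply/measurable_EFinP; apply: measurable_funM => //.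
  exact: measurable_expRM.
- exact: measurable_funTS.
- move=> t; rewrite in_itv /= => ty; rewrite lee_fin mulrC.
  rewrite ler_wpM2l ?expR_ge0 // lef_pV2 ?posrE ?prod_gt0 ?expR_gt0 //.
  apply: ler_prod => i _; rewrite addr_ge0 ?expR_ge0 ?(ltW (a_gt0 i)) //=.
  by rewrite lerD2r -(lnK y0) ler_expR.
Qed.

Lemma divdiff_exprn0 (M n : nat) : (n.+1 < M)%N ->
  divdiff a M (fun y => y `^ n%:R) = 0.
Proof.
case: M => // M; rewrite ltnS => nM.
have -> : divdiff a M.+1 (fun y => y `^ n%:R) = divdiff a M.+1 (horner 'X^n).
  by apply: eq_bigr => i _; rewrite hornerXn powR_mulrn // ltW.
rewrite divdiff_horner //; last by rewrite size_polyXn ltnS ltnW.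
by rewrite coefXn gtn_eqF.
Qed.

Lemma divdiff_powR_nonint_ge (M n : nat) (r y : R) :
  (n < M)%N -> 0 < r -> r < 1 -> 0 < y ->
  y `^ (n%:R + r) / ((n%:R + r) * \prod_(i < M) (y + a i)) * (r * (1 - r))
    <= (-1) ^+ (n + M.+1) * divdiff a M (fun y => y `^ (n%:R + r - 1)).
Proof.
move=> nM r0 r1 y0; have s0 : 0 < n%:R + r by rewrite ltr_wpDl.
have := integral_exp_div_prod_ge s0 y0 (integrable_exp_div_prod nM r0 r1).
rewrite (integral_exp_div_prod nM r0 r1).
set Q := y `^ _ / _; set D := (-1) ^+ _ * _.
have Q0 : 0 < Q.
  rewrite divr_gt0 ?powR_gt0 // mulr_gt0 // prodr_gt0 // => i _.
  by rewrite addr_gt0.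
have := integral_logistic_kernel_le r0 r1.
have := integral_logistic_kernel_ge0 r.
case: (\int[_]_t _)%E => // G; rewrite !lee_fin => G0 GI QDG.
have D0 : 0 <= D.
  rewrite leNgt; apply/negP => D0.
  by have := lt_le_trans Q0 QDG; rewrite ltNge mulr_le0_ge0 // ltW.
rewrite -ler_pdivlMr; last by rewrite mulr_gt0 // subr_gt0.
by apply: le_trans QDG _; rewrite ler_wpM2l.
Qed.

Lemma divdiff_powR_ge (M n : nat) (s y : R) : (n < M)%N ->
  n%:R <= s -> s < n%:R + 1 -> 0 < s -> 0 < y ->
  `|sin (pi * s)| / (2 * pi) * (y `^ s / (s * \prod_(i < M) (y + a i)))
    <= (-1) ^+ (n + M.+1) * divdiff a M (fun y => y `^ (s - 1)).
Proof.
move=> nM ns sn1 s0 y0; have pi0 := pi_gt0 R.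
have [r sE] : exists r, s = n%:R + r by exists (s - n%:R); rewrite addrC subrK.
have [r0 | r_neq0] := eqVneq r 0.
  case: n nM ns sn1 sE => [|n] nM ns sn1 sE; first by lra.
  have := @norm_sin_piM_le R n.+1 0; rewrite lexx ler01 mul0r mulr0 => /(_ isT).
  rewrite normr_le0 sE r0 addr0 => /eqP ->; rewrite normr0 !mul0r.
  by rewrite -[n.+1%:R]natr1 addrK divdiff_exprn0 ?mulr0.
have r0 : 0 < r by rewrite lt_def r_neq0 /=; lra.
have r1 : r < 1 by lra.
rewrite sE in s0 *; apply: le_trans (divdiff_powR_nonint_ge nM r0 r1 y0).
rewrite mulrC ler_wpM2l //.
  rewrite divr_ge0 ?powR_ge0 // mulr_ge0 ?(ltW s0) // prodr_ge0 // => i _.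
  by rewrite addr_ge0 // ltW.
rewrite ler_pdivrMr ?mulr_gt0 // [leRHS]mulrC.
by apply: norm_sin_piM_le; rewrite !ltW //.
Qed.

End DividedDifferencePowers.

(** * Alternating binomial sums *)

Lemma prod_subr_nat_neq (R : comNzRingType) (i t : nat) :
  \prod_(0 <= l < i.+1 + t | l != i) (i%:R - l%:R) =
  (-1) ^+ t * (i`! * t`!)%:R :> R.
Proof.
elim: t => [|t IH].
  rewrite addn0 big_mkcond big_nat_recr //= eqxx mulr1 mul1r muln1 fact_prod.
  rewrite natr_prod big_add1 big_nat_rev /= add0n.
  apply: eq_big_nat => l /andP[_ li]; rewrite natrB; last by lia.
  by rewrite ifT; [rewrite -natr1; ring|lia].
rewrite addnS big_mkcond big_nat_recr //= -big_mkcond /= IH.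
rewrite ifT; last by lia.
by rewrite factS !natrM natrD exprS; ring.
Qed.

Lemma prod_addn_fact (m n : nat) :
  (\prod_(0 <= l < m) (l + n.+1) * n`! = (m + n)`!)%N.
Proof.
elim: m => [|m IH]; first by rewrite big_geq // mul1n.
by rewrite big_nat_recr //= mulnAC IH addSn factS addnS mulnC.
Qed.

Section AlternatingBinomialSum.
Variable R : realType.

Definition square_node (i : nat) : R := i.+1%:R ^+ 2.

Lemma square_node_gt0 (i : nat) : 0 < square_node i.
Proof. by rewrite exprn_gt0. Qed.

Lemma square_node_inj : injective square_node.
Proof.
move=> i j /eqP; rewrite eqrXn2 // => /eqP /eqP.
by rewrite eqr_nat => /eqP [].
Qed.

Lemma prod_square_nodeB (M : nat) (i : 'I_M) :
  \prod_(l < M | l != i) (square_node i - square_node l) * (2 * square_node i) =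
  (-1) ^+ (M - i.+1) * ((M - i.+1)`! * (M + i.+1)`!)%:R.
Proof.
have ME : (M = i.+1 + (M - i.+1))%N by rewrite subnKC.
have fact_i0 : i`!%:R != 0 :> R by rewrite pnatr_eq0 -lt0n fact_gt0.
have differences : \prod_(l < M | l != i) (i%:R - l%:R) =
    (-1) ^+ (M - i.+1) * (i`! * (M - i.+1)`!)%:R :> R.
  rewrite -(big_mkord (fun l => l != i :> nat) (fun l => i%:R - l%:R)).
  by rewrite {1}ME prod_subr_nat_neq.
have sums : \prod_(l < M | l != i) (l + i.+2)%N%:R * (2 * i.+1%:R * i.+1`!%:R) =
    (M + i.+1)`!%:R :> R.
  rewrite -prod_addn_fact natrM big_mkord natr_prod [in RHS](bigD1 i) //=.
  by rewrite (_ : i + i.+2 = 2 * i.+1)%N ?natrM; [ring|lia].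
have -> : \prod_(l < M | l != i) (square_node i - square_node l) =
    \prod_(l < M | l != i) (i%:R - l%:R) *
    \prod_(l < M | l != i) (l + i.+2)%N%:R.
  rewrite -big_split /=; apply: eq_bigr => l _.
  by rewrite /square_node natrD; ring.
rewrite natrM -sums differences factS !natrM /square_node.
by apply: (mulfI fact_i0); ring.
Qed.

Definition altsum (M : nat) (p : R) : R :=
  \sum_(i < M) (-1) ^+ i.+1 * 'C(M.*2, M + i.+1)%:R * i.+1%:R `^ p.

Lemma altsum_divdiff (M : nat) (p : R) :
  altsum M p = (-1) ^+ M * ((M.*2)`!%:R / 2) *
    divdiff square_node M (fun y => y `^ (p / 2 - 1)).
Proof.
rewrite /divdiff mulr_sumr; apply: eq_bigr => i _.
have node0 := square_node_gt0 i.
have -> : i.+1%:R `^ p = square_node i * square_node i `^ (p / 2 - 1).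
  rewrite -{1}(powRr1 (ltW node0)) -powRD ?(gt_eqF node0) ?implybT //.
  by rewrite addrC subrK /square_node -powR_mulrn // -powRrM mulrC divfK.
have iM : (M + i.+1 <= M.*2)%N by rewrite -addnn leq_add2l.
have := bin_fact iM; rewrite -addnn subnDl => <-.
have := prod_square_nodeB i; set P := \prod_(l < M | _) _.
set e := (-1) ^+ (M - _) => PE.
have -> : (-1) ^+ M = e * (-1) ^+ i.+1 by rewrite -exprD subnK.
have fact0 (m : nat) : m`!%:R != 0 :> R by rewrite pnatr_eq0 -lt0n fact_gt0.
have P0 : P != 0.
  apply: contra_eq_neq PE => ->.
  by rewrite mul0r eq_sym mulf_neq0 ?signr_eq0 // natrM mulf_neq0.
have -> : square_node i = e * ((M - i.+1)`! * (M + i.+1)`!)%:R / (2 * P).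
  by rewrite -PE; field.
by move: (_ `^ _) => x; rewrite !natrM; field.
Qed.

Lemma prod_square_node_le (M : nat) (x : R) : 0 <= x ->
  \prod_(i < M) (x ^+ 2 + square_node i) <= M`!%:R ^+ 2 * expR (pi * x).
Proof.
move=> x0; have -> : \prod_(i < M) (x ^+ 2 + square_node i) =
    M`!%:R ^+ 2 * \prod_(i < M) (1 + (x / i.+1%:R) ^+ 2).
  rewrite fact_prod natr_prod big_add1 big_mkord /= -prodrXl -big_split /=.
  by apply: eq_bigr => i _; rewrite /square_node; field; rewrite nat1r.
by rewrite ler_wpM2l ?exprn_ge0 // prod_1Dsqr_le_expR.
Qed.

Lemma bin_double_fact (M : nat) : ('C(M.*2, M) * M`! ^ 2 = (M.*2)`!)%N.
Proof.
by have := @bin_fact M.*2 M; rewrite -addnn leq_addr addnK mulnn; exact.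
Qed.

Lemma altsum_ge (M n : nat) (p : R) :
  (n < M)%N -> 0 < p -> n%:R <= p / 2 -> p / 2 < n%:R + 1 ->
  `|sin (pi * p / 2)| / (2 * pi * p) * 'C(M.*2, M)%:R * (p / (expR 1 * pi)) `^ p
    <= (-1) ^+ n.+1 * altsum M p.
Proof.
move=> nM p0 np pn1; have pi0 := pi_gt0 R.
pose x := p / pi; have x0 : 0 < x by rewrite divr_gt0.
have s0 : 0 < p / 2 by rewrite divr_gt0.
have := divdiff_powR_ge square_node_gt0 square_node_inj nM np pn1 s0
  (exprn_gt0 2 x0).
rewrite mulrA -powR_mulrn ?(ltW x0) // -powRrM mulrC [2 * _]mulrC divfK //.
rewrite powR_mulrn ?(ltW x0) //.
set P := \prod_(i < M) _; set D := divdiff _ _ _ => PD.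
have P0 : 0 < P.
  by apply: prodr_gt0 => i _; rewrite addr_gt0 ?exprn_gt0 ?square_node_gt0.
have -> : (-1) ^+ n.+1 * altsum M p =
    (M.*2)`!%:R / 2 * ((-1) ^+ (n + M.+1) * D).
  by rewrite altsum_divdiff -/D !exprS addnS !exprS exprD; ring.
apply: le_trans (ler_wpM2l _ PD); rewrite ?divr_ge0 //.
have -> : (p / (expR 1 * pi)) `^ p = x `^ p * expR (- p).
  rewrite (_ : p / _ = x * expR (- 1)); last first.
    by rewrite expRN /x invfM mulrA mulrAC.
  by rewrite powRM ?expR_ge0 ?(ltW x0) // -expRM mulN1r.
have expRN_le : expR (- p) <= M`!%:R ^+ 2 / P.
  have <- : pi * x = p by rewrite mulrC divfK // gt_eqF.
  rewrite ler_pdivlMr // expRN ler_pdivrMl ?expR_gt0 // mulrC.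
  exact: prod_square_node_le (ltW x0).
pose K := `|sin (pi * p / 2)| / (2 * pi * p) * 'C(M.*2, M)%:R * x `^ p.
have K0 : 0 <= K by rewrite !mulr_ge0 ?powR_ge0 ?invr_ge0 ?mulr_ge0 // ltW.
have := ler_wpM2l K0 expRN_le; rewrite -bin_double_fact natrM natrX.
congr (_ <= _); first by rewrite mulrA.
rewrite /K; move: (@pi R) (lt0r_neq0 pi0) (P) (lt0r_neq0 P0) (_ `^ p) `|_|.
by move=> z z0 Q Q0 X sn; field; rewrite Q0 z0 gt_eqF.
Qed.

End AlternatingBinomialSum.

(** * Moment estimates *)

Section RealEstimates.
Local Open Scope classical_set_scope.
Variable R : realType.

Lemma sinh_le_mul_cosh (x : R) : 0 <= x ->
  expR x - expR (- x) <= x * (expR x + expR (- x)).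
Proof.
move=> x0.
pose f (s : R) : R := s * (expR s + expR (- s)) - (expR s - expR (- s)).
have f_df (s : R) : is_derive s 1 f (s * (expR s - expR (- s))).
  by apply: is_derive_eq; rewrite /GRing.scale /=; ring.
have [c /andP[c0 _]] := is_derive_MVT x0 f_df.
rewrite [x - 0]subr0 {2}/f mul0r oppr0 expR0 subrr !subr0 => fx.
by rewrite -subr_ge0 -/(f x) fx !mulr_ge0 // subr_ge0 ler_expR; lra.
Qed.

Lemma cosh_le_expR (x : R) : expR x + expR (- x) <= 2 * expR (x ^+ 2 / 2).
Proof.
wlog x0 : x / 0 <= x => [W|].
  have [/W//|/ltW xN] := leP 0 x.
  by have := W (- x); rewrite sqrrN opprK addrC oppr_ge0; exact.
pose f (s : R) : R := (expR s + expR (- s)) * expR (- (s ^+ 2 / 2)).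
have f_df (s : R) : is_derive s 1 f
    (((expR s - expR (- s)) - s * (expR s + expR (- s)))
       * expR (- (s ^+ 2 / 2))).
  by apply: is_derive_eq; rewrite /GRing.scale /=; field.
have [c /andP[c0 _]] := is_derive_MVT x0 f_df.
rewrite [x - 0]subr0 {2}/f expr0n mul0r oppr0 expR0 mulr1 => fx.
rewrite -ler_pdivrMr ?expR_gt0 // -expRN -/(f x) -subr_le0 fx.
by rewrite !mulr_le0_ge0 ?expR_ge0 // subr_le0 sinh_le_mul_cosh.
Qed.

Lemma powR_le_expRD (p lam x : R) : 0 < p -> 0 < lam ->
  `|x| `^ p <=
    (p / (expR 1 * lam)) `^ p * (expR (lam * x) + expR (- (lam * x))).
Proof.
move=> p0 lam0.
have [->|x_neq0] := eqVneq x 0.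
  by rewrite normr0 powR0 ?gt_eqF // mulr_ge0 ?powR_ge0 // addr_ge0 ?expR_ge0.
have x0 : 0 < `|x| by rewrite normr_gt0.
have two_sided : expR (lam * `|x|) <= expR (lam * x) + expR (- (lam * x)).
  have [_|_] := ger0P x; first by rewrite lerDl expR_ge0.
  by rewrite mulrN lerDr expR_ge0.
apply: le_trans (ler_wpM2l (powR_ge0 _ _) two_sided).
rewrite /powR gt_eqF // gt_eqF ?divr_gt0 ?mulr_gt0 ?expR_gt0 // -expRD ler_expR.
have z0 : 0 < lam * `|x| / p by rewrite divr_gt0 ?mulr_gt0.
have := ler_wpM2l (ltW p0) (ln_le_sub1 z0).
rewrite !(ln_div, lnM) ?posrE ?mulr_gt0 ?expR_gt0 // expRK.
have -> : p * (lam * `|x| / p - 1) = lam * `|x| - p by field; rewrite gt_eqF.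
lra.
Qed.

Lemma chernoff_optimum (p K : R) : 0 < p -> 0 < K ->
  (p / (expR 1 * Num.sqrt (p / K))) `^ p * expR (Num.sqrt (p / K) ^+ 2 / 2) `^ K
  = (p * K / expR 1) `^ (p / 2).
Proof.
move=> p0 K0; have e0 := expR_gt0 (1 : R).
have r0 : 0 < p / K by rewrite divr_gt0.
have s0 : 0 < Num.sqrt (p / K) by rewrite sqrtr_gt0.
have ln_sqrt : ln (Num.sqrt (p / K)) = (ln p - ln K) / 2.
  by rewrite -powR12_sqrt ?ltW // ln_powR ln_div ?posrE //; field.
rewrite sqr_sqrtr ?ltW // -expRM.
rewrite {1}/powR gt_eqF ?divr_gt0 ?mulr_gt0 // -expRD.
rewrite /powR gt_eqF ?divr_gt0 ?mulr_gt0 //; congr expR.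
rewrite !(ln_div, lnM) ?posrE ?mulr_gt0 // ln_sqrt expRK.
by field; rewrite gt_eqF.
Qed.

Lemma expR1_ge : 5 / 2 <= expR 1 :> R.
Proof.
apply: (@le_trans _ _ ((1 + 6^-1) ^+ 6)); first by lra.
have -> : expR 1 = expR 6^-1 ^+ 6 :> R by rewrite -expRM_natl divff.
by rewrite lerXn2r ?nnegrE ?expR_ge0 ?expR_ge1Dx //; lra.
Qed.

Lemma mulr_le_powR (x p : R) : expR 1 <= x -> 1 <= p -> x * p <= x `^ p.
Proof.
move=> ex p1; have x0 : 0 < x by exact: lt_le_trans (expR_gt0 1) ex.
have -> : x `^ p = x * x `^ (p - 1).
  by rewrite -{2}(powRr1 (ltW x0)) -powRD ?(gt_eqF x0) ?implybT // addrC subrK.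
rewrite ler_pM2l // (@le_trans _ _ (expR 1 `^ (p - 1))) //.
  by rewrite -expRM mul1r; have := expR_ge1Dx (p - 1); rewrite addrC subrK.
by apply: ge0_ler_powR; rewrite ?nnegrE ?expR_ge0 ?(ltW x0) // subr_ge0.
Qed.

Lemma moment_ratio_base_le (p k M : R) : 1 <= p -> 0 < k -> 0 < M ->
  3 * M <= 2 * k ->
  16 * pi ^+ 2 * M * (2 * p / (expR 1 ^+ 2 * pi ^+ 2 * k))
  <= (expR 1 * k / M) `^ p.
Proof.
move=> p1 k0 M0 Mk; have e0 := expR_gt0 (1 : R); have e52 := expR1_ge.
have pi0 := pi_gt0 R.
have base_le : 3 / 2 * expR 1 <= expR 1 * k / M by rewrite ler_pdivlMr //; nra.
have -> : 16 * pi ^+ 2 * M * (2 * p / (expR 1 ^+ 2 * pi ^+ 2 * k)) =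
    32 * (M / k) / expR 1 ^+ 2 * p.
  move: (@pi R) (lt0r_neq0 pi0) (expR 1 : R) (lt0r_neq0 e0) => z z0 e e_neq0.
  by field; rewrite z0 e_neq0 gt_eqF.
apply: (@le_trans _ _ (3 / 2 * expR 1 * p)); last first.
  apply: le_trans (mulr_le_powR _ p1) _; first by lra.
  apply: ge0_ler_powR => //; rewrite ?nnegrE; [lra..|].
  by rewrite divr_ge0 ?mulr_ge0 // ltW.
rewrite ler_wpM2r //; first by lra.
rewrite ler_pdivrMr ?exprn_gt0 // -[leRHS]mulrA -exprS.
have Mk_le : M / k <= 2 / 3 by rewrite ler_pdivrMr //; lra.
have : (5 / 2) ^+ 3 <= expR 1 ^+ 3 :> R by rewrite lerXn2r ?nnegrE //; lra.
by lra.
Qed.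

Lemma moment_ratio_le (p k M : R) :
  1 <= p -> 0 < k -> 0 < M -> 3 * M <= 2 * k ->
  (p * (2 * M) / expR 1) `^ (p / 2)
    * (2 * p / (expR 1 ^+ 2 * pi ^+ 2 * k)) `^ ((p + 1) / 2)
  <= 2 `^ p * (p / (expR 1 * pi)) `^ p / (4 * pi * Num.sqrt M).
Proof.
move=> p1 k0 M0 Mk; have e0 := expR_gt0 (1 : R); have pi0 := pi_gt0 R.
have p0 : 0 < p by lra.
set a := p * _ / _; set b := 2 * p / _; pose c := expR 1 * k / M.
have a0 : 0 < a by rewrite divr_gt0 ?mulr_gt0.
have b0 : 0 < b by rewrite divr_gt0 ?mulr_gt0 ?exprn_gt0.
have c0 : 0 < c by rewrite divr_gt0 ?mulr_gt0.
have sqrt_le : 4 * pi * Num.sqrt M * Num.sqrt b <= c `^ (p / 2).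
  have -> : c `^ (p / 2) = Num.sqrt (c `^ p).
    by rewrite -powR12_sqrt ?powR_ge0 // -powRrM.
  have -> : 4 * pi * Num.sqrt M * Num.sqrt b = Num.sqrt (16 * pi ^+ 2 * M * b).
    rewrite -[LHS]ger0_norm ?mulr_ge0 ?(ltW pi0) // -sqrtr_sqr.
    by rewrite !exprMn !sqr_sqrtr ?(ltW M0) ?(ltW b0) //; congr Num.sqrt; ring.
  by rewrite ler_wsqrtr // moment_ratio_base_le.
have -> : b `^ ((p + 1) / 2) = b `^ (p / 2) * Num.sqrt b.
  by rewrite mulrDl powRD ?(gt_eqF b0) ?implybT // mul1r powR12_sqrt // ltW.
have -> : 2 `^ p * (p / (expR 1 * pi)) `^ p =
    a `^ (p / 2) * b `^ (p / 2) * c `^ (p / 2).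
  have y0 : 0 <= p / (expR 1 * pi) by rewrite divr_ge0 ?mulr_ge0 // ltW.
  rewrite -(powRM _ (ler0n R 2) y0) -(powRM _ (ltW a0) (ltW b0)).
  rewrite -(powRM _ (mulr_ge0 (ltW a0) (ltW b0)) (ltW c0)).
  have -> : a * b * c = (2 * (p / (expR 1 * pi))) ^+ 2.
    rewrite /a /b /c; move: (@pi R) (lt0r_neq0 pi0) (expR 1 : R) (lt0r_neq0 e0).
    by move=> z z0 e e_neq0; field; rewrite z0 e_neq0 !gt_eqF.
  rewrite -(powR_mulrn 2 (mulr_ge0 (ler0n R 2) y0)) -powRrM.
  by rewrite [2 * (p / 2)]mulrC divfK.
rewrite ler_pdivlMr ?mulr_gt0 ?sqrtr_gt0 // mulrA -[leLHS]mulrA.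
rewrite ler_wpM2l ?mulr_ge0 ?powR_ge0 // mulrC.
exact: sqrt_le.
Qed.

End RealEstimates.

Lemma central_binomial_sqr_ge (M : nat) : (0 < M)%N ->
  (4 ^ M * 4 ^ M <= 4 * M * 'C(M.*2, M) ^ 2)%N.
Proof.
elim: M => // -[_ _|M IH _]; first by [].
have {}IH := IH isT; set m := M.+1 in IH *.
have rec : (m.+1 * 'C(m.+1.*2, m.+1) = 2 * m.*2.+1 * 'C(m.*2, m))%N.
  have diag := mul_bin_diag m.*2.+2 m.
  have := mul_bin_down m.*2.+1 m.
  rewrite -addnn subSn ?leq_addr // addnK addnn /= => down.
  rewrite doubleS -diag /=; apply/eqP; rewrite -(eqn_pmul2l (ltn0Sn m)).
  by apply/eqP; rewrite mulnCA -down; lia.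
rewrite -(leq_pmul2l (ltn0Sn m)).
apply: (@leq_trans (4 * (m.+1 * 'C(m.+1.*2, m.+1)) ^ 2)); last first.
  by apply: eq_leq; lia.
rewrite rec; move: IH; rewrite !expnS; move: (4 ^ m)%N 'C(m.*2, m) => a c.
by rewrite -muln2 !expn0 !muln1 => IH; nia.
Qed.

Lemma central_binomial_ge (R : rcfType) (M : nat) : (0 < M)%N ->
  4 ^+ M / (2 * Num.sqrt M%:R) <= 'C(M.*2, M)%:R :> R.
Proof.
move=> M0; have s0 : 0 < Num.sqrt M%:R :> R by rewrite sqrtr_gt0 ltr0n.
rewrite ler_pdivrMr ?mulr_gt0 //.
rewrite -(@ler_pXn2r _ 2) ?nnegrE ?exprn_ge0 ?mulr_ge0 ?sqrtr_ge0 //.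
rewrite !exprMn sqr_sqrtr ?ler0n //.
have := central_binomial_sqr_ge M0; rewrite -(ler_nat R) !natrM !natrX.
by rewrite (_ : 2 ^+ 2 = 4) -?expr2 => [|]; [rewrite mulrC|ring].
Qed.

(** * Sums over sign vectors *)

Section SignVectors.
Variables (R : comNzRingType) (k : nat).
Implicit Types u v : boolvec k.

Definition weight v : nat := (\sum_(i < k) v i)%N.
Definition sign_sum v : R := \sum_(i < k) (-1) ^+ v i.
Definition sign_prod v : R := \prod_(i < k) (-1) ^+ v i.
Definition bvxor u v : boolvec k := [ffun i => u i (+) v i].

Lemma sum_weight (F : nat -> R) :
  \sum_(v : boolvec k) F (weight v) = \sum_(j < k.+1) 'C(k, j)%:R * F j.
Proof.
have weight_lt v : (weight v < k.+1)%N.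
  rewrite ltnS -[leqRHS]card_ord -sum1_card; apply: leq_sum => i _.
  by case: (v i).
rewrite (partition_big (fun v => Ordinal (weight_lt v)) xpredT) //=.
apply: eq_bigr => j _; rewrite (eq_bigr (fun=> F j)); last by move=> v /eqP <-.
rewrite (eq_bigl (mem [set v | weight v == j])) => [|v]; last by rewrite /= inE.
rewrite sumr_const -[LHS]mulr_natl; congr (_%:R * _).
pose supp v : {set 'I_k} := [set i | v i].
have supp_inj : injective supp.
  by move=> u v /setP uv; apply/ffunP => i; have := uv i; rewrite !inE.
have card_supp v : #|supp v| = weight v.
  rewrite -sum1_card big_mkcond /=; apply: eq_bigr => i _.
  by rewrite inE; case: (v i).
have := card_draws 'I_k j; rewrite card_ord => <-.
rewrite -(card_imset _ supp_inj).
apply: eq_card => A; rewrite !inE; apply/imsetP/idP => [[v + ->]|/eqP cardA].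
  by rewrite inE card_supp.
have AE : A = supp [ffun i => i \in A] by apply/setP => i; rewrite inE ffunE.
by exists [ffun i => i \in A] => //; rewrite inE -card_supp -AE cardA.
Qed.

Lemma sign_sumE v : sign_sum v = k%:R - 2 * (weight v)%:R.
Proof.
rewrite natr_sum mulr_sumr -[X in X%:R - _]card_ord -sum1_card natr_sum -sumrB.
by apply: eq_bigr => i _; case: (v i); rewrite /= ?expr1 ?expr0; ring.
Qed.

Lemma sign_prodE v : sign_prod v = (-1) ^+ weight v.
Proof. by rewrite expr_sum. Qed.

Lemma sign_prod_addb v : sign_prod v = (-1) ^+ (\big[addb/false]_(i < k) v i).
Proof.
rewrite /sign_prod; elim/big_rec2: _ => [|i b1 y _ ->]; first by rewrite expr0.
by rewrite signr_addb.
Qed.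

Lemma bvxorK v : involutive (fun u => bvxor u v).
Proof. by move=> u; apply/ffunP => i; rewrite !ffunE addbK. Qed.

Lemma sign_prod_xor u v : sign_prod (bvxor u v) = sign_prod u * sign_prod v.
Proof.
rewrite /sign_prod -big_split; apply: eq_bigr => i _.
by rewrite ffunE signr_addb.
Qed.

End SignVectors.

Lemma exists_sign_prod (R : realDomainType) (k : nat) (s : bool) : (3 <= k)%N ->
  exists2 v : boolvec k, sign_prod R v = (-1) ^+ s & sign_sum R v < 0.
Proof.
move=> k3; have k0 : (0 < k)%N by lia.
have k3R : (3 : R) <= k%:R by rewrite ler_nat.
have weight_all : weight ([ffun=> true] : boolvec k) = k.
  by under [LHS]eq_bigr do rewrite ffunE; rewrite sum1_card card_ord.
pose i0 := Ordinal k0.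
have weight_but_one : weight ([ffun i => i != i0] : boolvec k) = k.-1.
  rewrite /weight (bigD1 i0) //= ffunE eqxx add0n (eq_bigr (fun=> 1%N)).
    by rewrite sum1_card cardC1 card_ord.
  by move=> i i_neq; rewrite ffunE i_neq.
have [k_s|k_Ns] := eqVneq (odd k) s.
  exists [ffun=> true]; first by rewrite sign_prodE weight_all -signr_odd k_s.
  by rewrite sign_sumE weight_all; lra.
exists [ffun i => i != i0].
  rewrite sign_prodE weight_but_one -signr_odd.
  by congr (_ ^+ (_ : bool)); move: k_Ns; lia.
by rewrite sign_sumE weight_but_one -subn1 natrB //; lra.
Qed.

Section SignMoments.
Variables (R : realType) (k : nat).

Lemma tstarE : tstar R k = (odd k)%:R.
Proof.
by rewrite /tstar -signr_odd /=; case: (odd k); rewrite /= ?expr0 ?expr1; field.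
Qed.

Lemma sign_col_signr (v : boolvec k) (i : 'I_k) :
  sign_col R v i 0 = (-1) ^+ v i.
Proof.
by rewrite !mxE; case: (v i); rewrite /= ?mulr0 ?mulr1 ?expr0 ?expr1; ring.
Qed.

Lemma sum_expR_sign_sum (lam t : R) :
  \sum_(v : boolvec k) expR (lam * (sign_sum R v - t)) =
  expR (- (lam * t)) * (expR lam + expR (- lam)) ^+ k.
Proof.
have -> : (expR lam + expR (- lam)) ^+ k =
    \prod_(i < k) \sum_(j : bool) expR (lam * (-1) ^+ j).
  rewrite -[X in _ ^+ X]card_ord -prodr_const; apply: eq_bigr => i _.
  by rewrite big_bool /= expr1 expr0 mulrN1 mulr1 addrC.
rewrite bigA_distr_bigA /= mulr_sumr; apply: eq_bigr => v _.
by rewrite mulrBr addrC expRD /sign_sum mulr_sumr expR_sum.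
Qed.

Definition abs_moment (p : R) : R :=
  \sum_(v : boolvec k) `|sign_sum R v - tstar R k| `^ p.

Definition parity_moment (p : R) : R :=
  \sum_(v : boolvec k) sign_prod R v * `|sign_sum R v - tstar R k| `^ p.

Lemma abs_moment_signed_gt0 (p : R) (s : bool) : (3 <= k)%N ->
  0 < abs_moment p + (-1) ^+ s * parity_moment p.
Proof.
move=> k3; have [v0 v0_s v0_lt0] := exists_sign_prod R s k3.
rewrite /abs_moment /parity_moment mulr_sumr -big_split /= (bigD1 v0) //=.
have deviation_gt0 : 0 < `|sign_sum R v0 - tstar R k|.
  by rewrite normr_gt0 lt_eqF // subr_lt0 tstarE (lt_le_trans v0_lt0).
rewrite ltr_pwDl //.
  by rewrite v0_s mulrA -expr2 sqrr_sign mul1r addr_gt0 ?powR_gt0.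
apply: sumr_ge0 => v _; rewrite mulrA -{1}[_ `^ _]mul1r -mulrDl.
rewrite mulr_ge0 ?powR_ge0 // sign_prod_addb -signr_addb.
by case: (_ (+) _); rewrite ?expr0 ?expr1; lra.
Qed.

Lemma norm_parity_moment_lt (p : R) : (3 <= k)%N ->
  `|parity_moment p| < abs_moment p.
Proof.
move=> k3; have := abs_moment_signed_gt0 p false k3.
have := abs_moment_signed_gt0 p true k3.
by rewrite expr0 expr1 ltr_norml; lra.
Qed.

Lemma sum_expR_deviation_le (lam : R) :
  \sum_(v : boolvec k) (expR (lam * (sign_sum R v - tstar R k)) +
                        expR (- lam * (sign_sum R v - tstar R k)))
  <= 2 ^+ k.+1 * expR (lam ^+ 2 / 2) ^+ (uphalf k).*2.
Proof.
set c := expR lam + expR (- lam); set E := expR _.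
have c0 : 0 <= c by rewrite addr_ge0 ?expR_ge0.
have -> : \sum_(v : boolvec k) (expR (lam * (sign_sum R v - tstar R k)) +
    expR (- lam * (sign_sum R v - tstar R k))) =
    2 ^+ (~~ odd k) * c ^+ (k + odd k).
  rewrite big_split /= (sum_expR_sign_sum lam) (sum_expR_sign_sum (- lam)).
  rewrite mulNr !opprK [expR (- lam) + _]addrC -/c tstarE exprD.
  case: (odd k); rewrite /= ?mulr1 ?mulr0 ?oppr0 ?expR0; last by ring.
  by rewrite /c; ring.
have -> : 2 ^+ k.+1 * E ^+ (uphalf k).*2 =
    2 ^+ (~~ odd k) * (2 * E) ^+ (k + odd k).
  rewrite exprMn mulrA -exprD; congr (2 ^+ _ * _ ^+ _); last by lia.
  by case: (odd k); lia.
rewrite ler_wpM2l ?exprn_ge0 // lerXn2r ?nnegrE ?mulr_ge0 ?expR_ge0 //.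
exact: cosh_le_expR.
Qed.

Lemma abs_moment_le (p : R) : 0 < p -> (0 < k)%N ->
  abs_moment p <= 2 ^+ k.+1 * (p * (uphalf k).*2%:R / expR 1) `^ (p / 2).
Proof.
move=> p0 k0; set K := (uphalf k).*2.
have K0 : (0 : R) < K%:R by rewrite ltr0n double_gt0; lia.
rewrite -(chernoff_optimum p0 K0); set lam := Num.sqrt _.
have lam0 : 0 < lam by rewrite sqrtr_gt0 divr_gt0.
rewrite mulrCA powR_mulrn ?expR_ge0 //.
apply: le_trans (ler_wpM2l (powR_ge0 _ _) (sum_expR_deviation_le lam)).
rewrite mulr_sumr; apply: ler_sum => v _.
by rewrite mulNr; exact: powR_le_expRD.
Qed.

End SignMoments.

Lemma sum_binS (R : comNzRingType) (n : nat) (F : nat -> R) :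
  \sum_(j < n.+2) 'C(n.+1, j)%:R * F j =
  \sum_(j < n.+1) 'C(n, j)%:R * (F (n - j)%N + F j.+1).
Proof.
under [RHS]eq_bigr do rewrite mulrDr.
rewrite big_split /= big_ord_recl /= bin0.
under eq_bigr do rewrite /bump /= add1n binS natrD mulrDl.
rewrite big_split /= addrA; congr (_ + _).
rewrite [RHS](reindex_inj rev_ord_inj) /= big_ord_recr /= bin_small //.
rewrite mul0r addr0 big_ord_recl subSS subn0 subnn binn !mul1r; congr (_ + _).
apply: eq_bigr => i _; rewrite lift0 subSS.
have i_lt := ltn_ord i; rewrite -[in RHS]bin_sub; last by lia.
by rewrite (_ : n - (n - i.+1) = i.+1)%N //; lia.
Qed.

Section ParityMoment.
Variable R : realType.

Definition alt_deviation (n : nat) (t p : R) : R :=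
  \sum_(j < n.+1) 'C(n, j)%:R * ((-1) ^+ j * `|n%:R - 2 * j%:R - t| `^ p).

Lemma alt_deviation_central (M : nat) (p : R) : p != 0 ->
  alt_deviation M.*2 0 p = 2 * 2 `^ p * (-1) ^+ M * altsum M p.
Proof.
move=> p0; rewrite /alt_deviation.
under eq_bigr do rewrite subr0.
pose G j : R := 'C(M.*2, j)%:R * ((-1) ^+ j * `|M.*2%:R - 2 * j%:R| `^ p).
have G_mid : G M = 0.
  by rewrite /G -mul2n natrM subrr normr0 powR0 // !mulr0.
have G_right (i : nat) : G (M + i.+1)%N =
    2 `^ p * (-1) ^+ M * ((-1) ^+ i.+1 * 'C(M.*2, M + i.+1)%:R * i.+1%:R `^ p).
  rewrite /G (_ : M.*2%:R - _ = - (2 * i.+1%:R)); last by rewrite -mul2n; ring.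
  by rewrite normrN ger0_norm // powRM // exprD; ring.
have G_left (i : nat) : (i < M)%N -> G (M - i.+1)%N = G (M + i.+1)%N.
  move=> iM; rewrite /G -(bin_sub (_ : (M + i.+1 <= M.*2)%N)); last by lia.
  rewrite (_ : M.*2 - (M + i.+1) = M - i.+1)%N; last by lia.
  congr (_ * (_ * _ `^ p)).
    by rewrite -signr_odd -[RHS]signr_odd oddB // oddD.
  rewrite natrB // -normrN; congr (`|_|).
  by rewrite -mul2n; ring.
rewrite -(big_mkord xpredT G) (@big_cat_nat _ _ _ M) //=; last by lia.
rewrite [X in _ + X]big_ltn; last by lia.
rewrite G_mid add0r big_nat_rev /= add0n.
have -> : \sum_(M.+1 <= j < M.*2.+1) G j = \sum_(0 <= i < M) G (M + i.+1)%N.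
  rewrite -{1}[M.+1]add0n big_addn (_ : M.*2.+1 - M.+1 = M)%N; last by lia.
  by apply: eq_bigr => i _; congr G; lia.
rewrite (eq_big_nat _ _ (F2 := fun i => G (M + i.+1)%N)); last first.
  by move=> i /andP[_ iM]; exact: G_left.
rewrite /altsum big_mkord -mulr2n -[LHS]mulr_natl -!mulrA; congr (_ * _).
by rewrite mulrA mulr_sumr; apply: eq_bigr => i _; exact: G_right.
Qed.

Lemma alt_deviationS_odd (n : nat) (p : R) : odd n ->
  alt_deviation n.+1 0 p = -2 * alt_deviation n 1 p.
Proof.
move=> odd_n; rewrite /alt_deviation mulr_sumr.
rewrite (sum_binS _ (fun j => (-1) ^+ j * `|n.+1%:R - 2 * j%:R - 0| `^ p)).
apply: eq_bigr => j _; have jn : (j <= n)%N by rewrite -ltnS.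
have -> : n.+1%:R - 2 * (n - j)%N%:R - 0 = - (n%:R - 2 * j%:R - 1) :> R.
  by rewrite natrB //; ring.
have -> : n.+1%:R - 2 * j.+1%:R - 0 = n%:R - 2 * j%:R - 1 :> R by ring.
have -> : (-1) ^+ (n - j) = - (-1) ^+ j :> R.
  by rewrite -signr_odd oddB // odd_n /= signrN signr_odd.
by rewrite normrN exprS; ring.
Qed.

Lemma parity_momentE (k : nat) (p : R) : p != 0 ->
  parity_moment k p =
  2 `^ p * (-1) ^+ k./2 * (2 - (odd k)%:R) * altsum (uphalf k) p.
Proof.
move=> p0; have -> : parity_moment k p = alt_deviation k (odd k)%:R p.
  rewrite /alt_deviation -(sum_weight k
    (fun j => (-1) ^+ j * `|k%:R - 2 * j%:R - (odd k)%:R| `^ p)).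
  by apply: eq_bigr => v _; rewrite sign_prodE sign_sumE tstarE.
rewrite uphalf_half; have := odd_double_half k; set m := k./2.
case: (boolP (odd k)) => [odd_k|_] /= kE.
  apply: (@mulfI _ (-2)); first by rewrite oppr_eq0.
  rewrite -alt_deviationS_odd // -[in LHS]kE !add1n -doubleS.
  by rewrite alt_deviation_central // exprS; ring.
by rewrite -[in LHS]kE !add0n subr0 alt_deviation_central //; ring.
Qed.

Lemma subr_odd_gt0 (k : nat) : 0 < 2 - (odd k)%:R :> R.
Proof. by case: (odd k) => /=; lra. Qed.

Lemma parity_moment_ge (k : nat) (p : R) : 1 <= p -> p < k%:R ->
  2 `^ p * (2 - (odd k)%:R) *
    (`|sin (pi * p / 2)| / (2 * pi * p) * 'C((uphalf k).*2, uphalf k)%:R *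
     (p / (expR 1 * pi)) `^ p)
  <= - ((-1) ^+ (k./2 + Num.truncn (p / 2)) * parity_moment k p).
Proof.
move=> p1 pk; set n := Num.truncn _; set M := uphalf k.
have p0 : 0 < p by lra.
have /andP[np pn1] : n%:R <= p / 2 < n.+1%:R by apply: truncn_itv; lra.
have nM : (n < M)%N.
  rewrite -ltn_double -(ltr_nat R) -muln2 natrM.
  rewrite (_ : M.*2 = k + odd k)%N; last by lia.
  by rewrite natrD; have : 0 <= (odd k)%:R :> R by []; lra.
rewrite -[n.+1%:R]natr1 in pn1; have altsum_lb := altsum_ge nM p0 np pn1.
have -> : - ((-1) ^+ (k./2 + n) * parity_moment k p) =
    2 `^ p * (2 - (odd k)%:R) * ((-1) ^+ n.+1 * altsum M p).
  have sign2 : (-1) ^+ k./2 * (-1) ^+ k./2 = 1 :> R by rewrite -expr2 sqrr_sign.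
  transitivity ((-1) ^+ k./2 * (-1) ^+ k./2 *
      (2 `^ p * (2 - (odd k)%:R) * ((-1) ^+ n.+1 * altsum M p))).
    by rewrite parity_momentE ?gt_eqF // exprD exprS -/M; ring.
  by rewrite sign2 mul1r.
by rewrite ler_wpM2l // mulr_ge0 ?powR_ge0 ?(ltW (subr_odd_gt0 k)).
Qed.

Lemma parity_moment_sign (k : nat) (p : R) : 1 <= p -> p < k%:R ->
  (-1) ^+ (k./2 + Num.truncn (p / 2)) * parity_moment k p =
  - `|parity_moment k p|.
Proof.
move=> p1 pk; have := parity_moment_ge p1 pk.
set lower := 2 `^ p * _ * _; set e := (-1) ^+ _ => lower_le.
have lower_ge0 : 0 <= lower.
  have pi0 := pi_gt0 R.
  rewrite !mulr_ge0 ?(ltW (subr_odd_gt0 k)) ?powR_ge0 ?invr_ge0 //.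
  by rewrite !mulr_ge0 ?(ltW pi0) //; lra.
rewrite -[in RHS](normrMsign (odd (k./2 + Num.truncn (p / 2)))) signr_odd -/e.
rewrite ler0_norm ?opprK //; lra.
Qed.

Lemma parity_moment_ratio_ge (k : nat) (p : R) :
  1 <= p -> p < k%:R -> (1 < k)%N ->
  `|sin (pi * p / 2)| / p
    * (2 * p / (expR 1 ^+ 2 * pi ^+ 2 * k%:R)) `^ ((p + 1) / 2) * abs_moment k p
  <= `|parity_moment k p|.
Proof.
move=> p1 pk k1; have p0 : 0 < p by lra.
have pi0 := pi_gt0 R; set M := uphalf k; set sn := `|sin _|.
have ME : (M.*2 = k + odd k)%N by rewrite /M; lia.
have M0 : (0 < M)%N by rewrite /M; lia.
have M0R : 0 < M%:R :> R by rewrite ltr0n.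
have Mk : 3 * M%:R <= 2 * k%:R :> R.
  by rewrite -!natrM ler_nat /M; lia.
have := parity_moment_ge p1 pk; rewrite parity_moment_sign // opprK -/M -/sn.
set tau := 2 - _; set Z := (p / _) `^ p; set Y := _ `^ ((p + 1) / 2) => B_ge.
have tau0 : 0 < tau := subr_odd_gt0 k.
have tau_pow : tau * 4 ^+ M = 2 ^+ k.+1.
  rewrite (_ : 4 = 2 ^+ 2) -?exprM ?mul2n; last by ring.
  by rewrite ME /tau; case: (odd k); rewrite /= ?addn1 ?addn0 !exprS; ring.
have A_le : abs_moment k p * Y <=
    2 ^+ k.+1 * (2 `^ p * Z / (4 * pi * Num.sqrt M%:R)).
  apply: le_trans (ler_wpM2r (powR_ge0 _ _) (abs_moment_le p0 (ltnW k1))) _.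
  rewrite -[leLHS]mulrA ler_pM2l ?exprn_gt0 // -/M -mul2n natrM.
  by apply: moment_ratio_le => //; rewrite ltr0n ltnW.
apply: le_trans B_ge; rewrite -mulrA [Y * _]mulrC.
apply: le_trans (ler_wpM2l _ A_le) _.
  by rewrite divr_ge0 ?normr_ge0 // ltW.
have -> : sn / p * (2 ^+ k.+1 * (2 `^ p * Z / (4 * pi * Num.sqrt M%:R))) =
    2 `^ p * tau * (sn / (2 * pi * p) * (4 ^+ M / (2 * Num.sqrt M%:R)) * Z).
  rewrite -tau_pow; have : Num.sqrt M%:R != 0 :> R by rewrite gt_eqF ?sqrtr_gt0.
  move: (@pi R) (lt0r_neq0 pi0) (Z) (sn) (Num.sqrt _) => z z0 X s q q0.
  by field; rewrite z0 q0 gt_eqF.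
rewrite ler_wpM2l ?mulr_ge0 ?powR_ge0 ?(ltW tau0) // ler_wpM2r ?powR_ge0 //.
rewrite ler_wpM2l ?central_binomial_ge // divr_ge0 ?normr_ge0 //.
by rewrite !mulr_ge0 // ltW.
Qed.

End ParityMoment.

(** * The parallelepiped *)

Section LpNorm.
Variables (R : realType) (p : R).
Hypothesis p_gt0 : 0 < p.

Lemma lpnorm_powR (d : nat) (x : 'cV[R]_d) :
  lpnorm p x `^ p = \sum_(i < d) `|x i 0| `^ p.
Proof.
rewrite -powRrM mulVf ?gt_eqF // powRr1 //.
by apply: sumr_ge0 => i _; exact: powR_ge0.
Qed.

Lemma powRK (x : R) : 0 <= x -> (x `^ p) `^ p^-1 = x.
Proof. by move=> x0; rewrite -powRrM divff ?gt_eqF // powRr1. Qed.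

Lemma lpnormZ (c : R) (d : nat) (x : 'cV[R]_d) :
  0 <= c -> lpnorm p (c *: x) = c * lpnorm p x.
Proof.
move=> c0; rewrite -[RHS]powRK ?mulr_ge0 ?powR_ge0 // powRM ?powR_ge0 //.
rewrite lpnorm_powR mulr_sumr /lpnorm; congr (_ `^ _); apply: eq_bigr => i _.
by rewrite mxE normrM powRM // ger0_norm.
Qed.

Lemma isolating_parallelepiped_of_signs (k d : nat) (C : boolvec k -> bool)
    (a eps : R) (W : 'M[R]_(d, k)) (w : 'cV[R]_d) :
  0 < a -> 0 <= eps -> \rank W = k ->
  (forall x, lpnorm p (W *m sign_col R x - w) `^ p =
     if C x then a else a * (1 + eps) `^ p) ->
  isolating_parallelepiped p C eps ((a `^ p^-1)^-1 *: ((-2) *: W))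
    ((a `^ p^-1)^-1 *: (w - W *m const_mx 1)).
Proof.
move=> a0 eps0 rankW normE; set c := (a `^ p^-1)^-1.
have c0 : 0 < c by rewrite invr_gt0 powR_gt0.
have affineE x : c *: ((-2) *: W) *m bit_col R x - c *: (w - W *m const_mx 1) =
    c *: (W *m sign_col R x - w).
  rewrite -scalemxAl -scalerBr; congr (_ *: _).
  rewrite /sign_col mulmxBr -scalemxAr -scalemxAl scaleNr opprB.
  by rewrite addrCA addrA.
have norm_scaled x (z : R) : 0 <= z ->
    lpnorm p (W *m sign_col R x - w) `^ p = a * z `^ p ->
    lpnorm p (c *: ((-2) *: W) *m bit_col R x - c *: (w - W *m const_mx 1)) = z.
  move=> z0 normWx; rewrite affineE lpnormZ ?(ltW c0) //.
  rewrite -[lpnorm p _]powRK ?powR_ge0 // normWx powRM ?powR_ge0 ?(ltW a0) //.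
  by rewrite powRK // mulrA mulVf ?mul1r // gt_eqF ?powR_gt0.
split=> //.
- by rewrite !mxrank_scale_nz ?oppr_eq0 ?gt_eqF.
- by move=> x Cx; apply: norm_scaled => //; rewrite normE Cx powR1 mulr1.
- by move=> x Cx; apply: norm_scaled; rewrite ?normE ?Cx // addr_ge0.
Qed.

End LpNorm.

Section SignFunctionals.
Variables (R : realDomainType) (k : nat) (s : bool) (z : 'I_k -> R).
Hypothesis k_ge3 : (3 <= k)%N.
Hypothesis z_vanish : forall u : boolvec k,
  sign_prod R u = (-1) ^+ s -> \sum_(j < k) z j * (-1) ^+ u j = 0.

Lemma sign_functional_pair (u : boolvec k) (i j : 'I_k) :
  sign_prod R u = (-1) ^+ s -> i != j ->
  z i * (-1) ^+ u i + z j * (-1) ^+ u j = 0.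
Proof.
(* Flipping the signs at i and j preserves the product of all signs. *)
move=> u_s ij; pose f : boolvec k := [ffun l => (l == i) || (l == j)].
have f_even : sign_prod R f = 1.
  rewrite /sign_prod (bigD1 i) //= (bigD1 j) ?[j == i]eq_sym //=.
  rewrite big1 => [|l /andP[li lj]].
    by rewrite !ffunE !eqxx orbT mulr1 -expr2 sqrr_sign.
  by rewrite ffunE (negbTE li) (negbTE lj).
have : \sum_(l < k) (z l * (-1) ^+ u l - z l * (-1) ^+ (bvxor u f) l) = 0.
  by rewrite sumrB !z_vanish ?subrr // sign_prod_xor f_even mulr1.
rewrite (bigD1 i) //= (bigD1 j) ?[j == i]eq_sym //=.
rewrite big1 => [|l /andP[li lj]]; last first.
  by rewrite !ffunE (negbTE li) (negbTE lj) addbF subrr.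
by rewrite !ffunE !eqxx orbT !addbT !signrN; lra.
Qed.

Lemma exists_two_others (i : 'I_k) :
  exists j l : 'I_k, [/\ i != j, i != l & j != l].
Proof.
pose o (m : nat) (m3 : (m < 3)%N) : 'I_k := Ordinal (leq_trans m3 k_ge3).
case: (boolP (i == o 0%N isT)) => [/eqP ->|i0].
  by exists (o 1%N isT), (o 2 isT).
case: (boolP (i == o 1%N isT)) => [/eqP ->|i1].
  by exists (o 0%N isT), (o 2 isT).
by exists (o 0%N isT), (o 1%N isT).
Qed.

Lemma sign_functional_eq0 (i : 'I_k) : z i = 0.
Proof.
have [u u_s _] := exists_sign_prod R s k_ge3.
have [j [l [ij il jl]]] := exists_two_others i.
have := sign_functional_pair u_s ij; have := sign_functional_pair u_s il.
have := sign_functional_pair u_s jl => jl0 il0 ij0.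
have /eqP : z i * (-1) ^+ u i = 0 by lra.
by rewrite mulf_eq0 signr_eq0 orbF => /eqP.
Qed.

End SignFunctionals.

Section SignMatrix.
Variables (R : realType) (p : R) (k : nat) (b : bool).
Hypothesis p_gt0 : 0 < p.

Lemma WmxE (i : 'I_(nsigns k)) (j : 'I_k) :
  Wmx p k b i j = alpha p b (row_sign R i) `^ p^-1 * (-1) ^+ (enum_val i) j.
Proof. by rewrite mxE /row_sign sign_col_signr. Qed.

Lemma wvec_sub_Wmx_ones (i : 'I_(nsigns k)) :
  (wvec p k b - Wmx p k b *m const_mx 1) i 0 =
  - (alpha p b (row_sign R i) `^ p^-1 * (sign_sum R (enum_val i) - tstar R k)).
Proof.
rewrite mxE [wvec _ _ _ _ _]mxE mxE [(_ *m _) _ _]mxE mulrBr opprB.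
rewrite /sign_sum mulr_sumr; congr (_ - _); apply: eq_bigr => j _.
by rewrite WmxE [const_mx _ _ _]mxE mulr1.
Qed.

Definition row_parity : bool := odd (k./2 + Num.truncn (p / 2)) (+) b.

Lemma alpha_sign_prod (u : boolvec k) :
  alpha p b (sign_col R u) = 1 + (-1) ^+ row_parity * sign_prod R u.
Proof.
rewrite /alpha /eta_exp; congr (1 + _ * _); last first.
  by apply: eq_bigr => i _; rewrite sign_col_signr.
have -> : Num.floor (p / 2) = Num.truncn (p / 2) :> int.
  have half_ge0 : 0 <= p / 2 by rewrite divr_ge0 // ltW.
  by rewrite truncn_floor half_ge0 gez0_abs // floor_ge0.
by rewrite divn2 -!PoszD -exprnP -[LHS]signr_odd oddD oddb.
Qed.

Lemma alpha_nat (u : boolvec k) :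
  alpha p b (sign_col R u) = (2 * (sign_prod R u == (-1) ^+ row_parity))%:R.
Proof.
rewrite alpha_sign_prod sign_prod_addb; move: row_parity (\big[_/_]_(_ < _) _).
have N1_neq1 : (-1 == 1 :> R) = false by apply/eqP; lra.
by case; case; rewrite /= ?expr0 ?expr1 ?eqxx ?N1_neq1 ?[1 == -1]eq_sym ?N1_neq1
  ?muln1 ?muln0 ?mulrNN ?mulr1 ?mul1r ?subrr.
Qed.

Lemma lpnorm_sign_matrix (x : boolvec k) :
  lpnorm p (Wmx p k b *m sign_col R x - wvec p k b) `^ p =
  abs_moment k p + (-1) ^+ row_parity * sign_prod R x * parity_moment k p.
Proof.
have alpha_ge0 (u : boolvec k) : 0 <= alpha p b (sign_col R u).
  by rewrite alpha_nat.
rewrite lpnorm_powR //.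
transitivity (\sum_(u : boolvec k) alpha p b (sign_col R u) *
    `|\sum_(i < k) (-1) ^+ u i * (-1) ^+ x i - tstar R k| `^ p).
  rewrite (reindex (@enum_val _ (mem {: boolvec k}))) /=; last first.
    by apply: onW_bij; exact: enum_val_bij.
  apply: eq_bigr => i _; rewrite !mxE.
  under [in LHS]eq_bigr do rewrite WmxE sign_col_signr -mulrA.
  rewrite -mulr_sumr -mulrBr normrM powRM // ger0_norm ?powR_ge0 //.
  by rewrite -powRrM mulVf ?gt_eqF // powRr1 // alpha_ge0.
rewrite (reindex_inj (inv_inj (@bvxorK k x))) /=.
rewrite /abs_moment /parity_moment mulr_sumr -big_split /=.
apply: eq_bigr => v _; rewrite alpha_sign_prod sign_prod_xor.
have -> : \sum_(i < k) (-1) ^+ (bvxor v x) i * (-1) ^+ x i = sign_sum R v.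
  by apply: eq_bigr => i _; rewrite ffunE -signr_addb addbK.
by ring.
Qed.

Lemma rank_sign_matrix : (3 <= k)%N -> \rank (Wmx p k b) = k.
Proof.
move=> k3; rewrite -mxrank_tr; apply/eqP; apply: inj_row_free => z zW.
apply/rowP => i; rewrite mxE.
apply: (@sign_functional_eq0 R k row_parity (fun j => z 0 j)) => // u u_s.
have /rowP /(_ (enum_rank u)) := zW; rewrite !mxE.
rewrite (eq_bigr (fun j => 2 `^ p^-1 * (z 0 j * (-1) ^+ u j))) => [|j _].
  by rewrite -mulr_sumr => /eqP; rewrite mulf_eq0 gt_eqF ?powR_gt0 // => /eqP.
by rewrite mxE WmxE /row_sign enum_rankK alpha_nat u_s eqxx muln1 mulrCA.
Qed.

End SignMatrix.

Lemma ratio_root_ge (R : realType) (A B p : R) : 0 < p -> 0 <= B -> B < A ->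
  B / (p * A) <= ((A + B) / (A - B)) `^ p^-1 - 1.
Proof.
move=> p0 B0 BA; have A0 : 0 < A by lra.
have AB_sub : 0 < A - B by lra.
have AB_add : 0 < A + B by lra.
have ln_ge : B / A <= ln ((A + B) / (A - B)).
  have := ln_le_sub1 (divr_gt0 AB_sub AB_add).
  rewrite !ln_div ?posrE // => ln_le.
  have : B / A <= 1 - (A - B) / (A + B).
    have -> : 1 - (A - B) / (A + B) = 2 * B / (A + B) by field; rewrite gt_eqF.
    by rewrite ler_pdivrMr // mulrAC ler_pdivlMr //; nra.
  lra.
rewrite /powR gt_eqF ?divr_gt0 // lerBrDl.
apply: le_trans (expR_ge1Dx _).
by rewrite lerD2l invfM mulrCA ler_pM2l ?invr_gt0.
Qed.

Section ParityParallelepiped.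
Variables (R : realType) (k : nat) (p : R).
Hypotheses (k_ge3 : (3 <= k)%N) (p_ge1 : 1 <= p) (p_lt_k : p < k%:R).

Let p_gt0 : 0 < p. Proof. exact: lt_le_trans ltr01 p_ge1. Qed.

Definition near_value : R := abs_moment k p - `|parity_moment k p|.
Definition far_value : R := abs_moment k p + `|parity_moment k p|.
Definition isolation_gap : R := (far_value / near_value) `^ p^-1 - 1.

Lemma near_value_gt0 : 0 < near_value.
Proof. by rewrite subr_gt0 norm_parity_moment_lt. Qed.

Lemma far_value_gt0 : 0 < far_value.
Proof.
by apply: lt_le_trans near_value_gt0 _; rewrite lerD2l ge0_cp // normr_ge0.
Qed.

Lemma isolation_gap_ge :
  `|sin (pi * p / 2)| / p ^+ 2
    * (2 * p / (expR 1 ^+ 2 * pi ^+ 2 * k%:R)) `^ ((p + 1) / 2)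
  <= isolation_gap.
Proof.
have B_lt_A := norm_parity_moment_lt p k_ge3.
have A0 : 0 < abs_moment k p by exact: le_lt_trans (normr_ge0 _) B_lt_A.
apply: le_trans (ratio_root_ge p_gt0 (normr_ge0 _) B_lt_A).
rewrite ler_pdivlMr ?mulr_gt0 //.
have := parity_moment_ratio_ge p_ge1 p_lt_k (ltnW k_ge3); congr (_ <= _).
by move: `|sin _| (_ `^ ((p + 1) / 2)) => sn Y; field; rewrite gt_eqF.
Qed.

Lemma isolation_gap_ge0 : 0 <= isolation_gap.
Proof.
apply: le_trans isolation_gap_ge.
by rewrite mulr_ge0 ?powR_ge0 ?divr_ge0 ?exprn_ge0 // ltW.
Qed.

Lemma near_value_gap : near_value * (1 + isolation_gap) `^ p = far_value.
Proof.
rewrite /isolation_gap addrC subrK -powRrM mulVf ?gt_eqF // powRr1.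
  by rewrite mulrC divfK // gt_eqF // near_value_gt0.
by rewrite divr_ge0 // ltW ?near_value_gt0 ?far_value_gt0.
Qed.

Lemma lpnorm_parity (b : bool) (x : boolvec k) :
  lpnorm p (Wmx p k b *m sign_col R x - wvec p k b) `^ p =
  if parity_constraint b x then near_value
  else near_value * (1 + isolation_gap) `^ p.
Proof.
rewrite near_value_gap lpnorm_sign_matrix // sign_prod_addb /row_parity.
rewrite /parity_constraint signr_addb signr_odd.
set parity := \big[addb/false]_(i < k) x i.
have -> : (-1) ^+ (k./2 + Num.truncn (p / 2)) * (-1) ^+ b * (-1) ^+ parity *
    parity_moment k p = (-1) ^+ (b (+) parity) * - `|parity_moment k p|.
  by rewrite -parity_moment_sign // signr_addb; ring.
rewrite /near_value /far_value.
by case: b; case: parity; rewrite /= ?expr0 ?expr1; ring.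
Qed.

End ParityParallelepiped.

Section Computability.
Variables (R : realType) (phi : nat -> nat) (p : R).
Hypotheses (p_gt0 : 0 < p) (approx_p : approximable phi p).

Lemma approximable_nat_powR (m : nat) : approximable phi (m%:R `^ p).
Proof.
case: m => [|m].
  by rewrite powR0 ?gt_eqF //; exact: (approximable_nat _ _ 0).
by apply: approximable_powR => //; exact: approximable_nat.
Qed.

Lemma sign_sum_int (k : nat) (v : boolvec k) :
  sign_sum R v - tstar R k = (k%:Z - 2 * (weight v)%:Z - (odd k)%:Z)%:~R.
Proof. by rewrite sign_sumE tstarE !rmorphB /= rmorphM /=. Qed.

Lemma approximable_signed_moment (k : nat) (s : bool) :
  approximable phi (abs_moment k p + (-1) ^+ s * parity_moment k p).
Proof.
rewrite /abs_moment /parity_moment mulr_sumr -big_split /=.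
apply: approximable_sum => v.
rewrite sign_sum_int -intr_norm -abszE; set y := _ `^ p.
have -> : y + (-1) ^+ s * (sign_prod R v * y) =
    (2 * (~~ (s (+) \big[addb/false]_(i < k) v i)))%N%:R * y.
  rewrite sign_prod_addb mulrA -signr_addb -{1}[y]mul1r -mulrDl; congr (_ * _).
  by case: (_ (+) _); rewrite /= ?expr0 ?expr1 ?subrr.
by apply: approximable_natM; exact: approximable_nat_powR.
Qed.

Lemma approximable_scaled_root (a : R) (N : nat) :
  0 < a -> approximable phi a ->
  approximable phi ((a `^ p^-1)^-1 * N%:R `^ p^-1).
Proof.
move=> a0 approx_a; case: N => [|N].
  by rewrite powR0 ?invr_eq0 ?gt_eqF // mulr0; exact: (approximable_nat _ _ 0).
have -> : (a `^ p^-1)^-1 * N.+1%:R `^ p^-1 = (N.+1%:R * a^-1) `^ p^-1.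
  rewrite powRM ?invr_ge0 ?(ltW a0) // mulrC; congr (_ * _).
  by rewrite -(powR_inv1 (ltW a0)) -powRrM mulN1r powRN.
apply: approximable_powR; first by rewrite mulr_gt0 ?invr_gt0.
  by apply: approximable_natM; exact: approximable_inv.
exact: approximable_inv.
Qed.

End Computability.

Lemma computable_sign_matrix (R : realType) (k : nat) (p a : R) (b : bool) :
  0 < p -> 0 < a -> (forall phi, dyadic_name p phi -> approximable phi a) ->
  computable_parallelepiped p ((a `^ p^-1)^-1 *: ((-2) *: Wmx p k b))
    ((a `^ p^-1)^-1 *: (wvec p k b - Wmx p k b *m const_mx 1)).
Proof.
move=> p0 a0 approx_a; set c := (a `^ p^-1)^-1.
pose row_scale (i : 'I_(nsigns k)) := c * alpha p b (row_sign R i) `^ p^-1.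
have approx_row i phi : dyadic_name p phi -> approximable phi (row_scale i).
  move=> phi_p; rewrite /row_scale /row_sign alpha_nat //.
  apply: approximable_scaled_root => //; last exact: approx_a.
  exact: approximable_name.
split=> [i j|i].
  have -> : (c *: ((-2) *: Wmx p k b)) i j =
      (if enum_val i j then 2%:Z else - 2%:Z)%:~R * row_scale i.
    rewrite mxE mxE WmxE /row_scale; move: (alpha _ _ _ `^ _) => r.
    by case: (enum_val i j); rewrite ?mulrNz /= ?expr0 ?expr1 -pmulrn; ring.
  by apply: computable_from_intM; exact: approx_row.
rewrite mxE wvec_sub_Wmx_ones sign_sum_int mulrN mulrA mulrC -mulNr -rmorphN.
by apply: computable_from_intM; exact: approx_row.
Qed.

Theorem theorem4p5 (R : realType) (k : nat) (p : R) (b : bool)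
    (hk : (3 <= k)%N) (hp1 : 1 <= p) (hpk : p < k%:R) :
  exists (eps : R) (V : 'M[R]_(nsigns k, k)) (t : 'cV[R]_(nsigns k)),
    [/\ `|sin (pi * p / 2)| / p ^+ 2
          * (2 * p / (expR 1 ^+ 2 * pi ^+ 2 * k%:R)) `^ ((p + 1) / 2) <= eps,
        isolating_parallelepiped p (@parity_constraint b k) eps V t,
        computable_parallelepiped p V t,
        exists c : R,
          [/\ 0 < c,
              V = c *: ((-2) *: Wmx p k b)
            & t = c *: (wvec p k b - Wmx p k b *m const_mx 1)]
      & exists a : R, forall x : boolvec k,
          lpnorm p (Wmx p k b *m sign_col R x - wvec p k b) `^ p =
            if parity_constraint b x then a else a * (1 + eps) `^ p].
Proof.
have p0 : 0 < p by lra.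
have a0 := near_value_gt0 p hk; set a := near_value k p in a0.
have normE := lpnorm_parity hk hp1 hpk b.
exists (isolation_gap k p), ((a `^ p^-1)^-1 *: ((-2) *: Wmx p k b)),
  ((a `^ p^-1)^-1 *: (wvec p k b - Wmx p k b *m const_mx 1)); split.
- exact: isolation_gap_ge.
- apply: isolating_parallelepiped_of_signs => //.
    exact: isolation_gap_ge0.
  exact: rank_sign_matrix.
- apply: computable_sign_matrix => // phi /approximable_name approx_p.
  rewrite /a /near_value -parity_moment_sign // -signr_odd.
  exact: approximable_signed_moment.
- by exists (a `^ p^-1)^-1; split=> //; rewrite invr_gt0 powR_gt0.
- by exists a.
Qed.
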